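(* Let $G$ be a nilpotent group of class $\leq 3$ and suppose that $[[G,G],G]$ has exponent dividing $3$. Then $\mathscr{C}(\mathcal{N}_{3},G)$ is (i) $1$-connected if and only if $G$ is a $2$-Engel group; (ii) $2$-connected if and only if $G$ is nilpotent of class $\leq 2$.
   Context: For a group $G$ and a family $\mathcal{F}$ of subgroups of $G$, the coset poset $\mathscr{C}(\mathcal{F},G)$ is the set of left cosets $\{gH\mid g\in G,\ H\in\mathcal{F}\}$ partially ordered by inclusion; the same symbol denotes the geometric realization of its order complex (the simplicial complex whose $n$-simplices are the strictly increasing chains of $n+1$ cosets). $\mathcal{N}_{3}$ denotes the family of all subgroups of $G$ that are nilpotent of class at most $2$. A space is $k$-connected if it is nonempty and $\pi_i=0$ for all $i\leq k$. Commutators: $[x,y]=x^{-1}y^{-1}xy$ and $[x,y,z]=[[x,y],z]$. A group $G$ is $2$-Engel if $[x,y,y]=1$ for all $x,y\in G$. *)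

(* Defs.v *)
From HB Require Import structures.
From mathcomp Require Import all_boot all_order all_algebra.
From mathcomp Require Import all_classical all_reals all_analysis.

Set Implicit Arguments.
Unset Strict Implicit.
Unset Printing Implicit Defensive.

Import Order.TTheory GRing.Theory Num.Theory.
Import numFieldNormedType.Exports.

Local Open Scope classical_set_scope.

Section Groups.
Variable G : groupType.
Implicit Types (A B H : set G) (F : set (set G)).

Local Open Scope group_scope.

Definition subgroup H : Prop :=
  [/\ H 1, forall x y, H x -> H y -> H (x * y) & forall x, H x -> H x^-1].

Definition generated A : set G := smallest subgroup A.

Definition commutator_subgroup A B : set G :=
  generated [set z | exists x y, [/\ A x, B y & z = [~ x, y]]].

(* Indexing is shifted by one: lower_central H n is usually written
   gamma_(n+1)(H), so that lower_central H 0 = H and H has class at most c iff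
   lower_central H c is trivial. *)
Fixpoint lower_central H (n : nat) : set G :=
  if n is m.+1 then commutator_subgroup (lower_central H m) H else H.

Definition nilpotent_class_le (c : nat) H : Prop :=
  lower_central H c = [set 1].

Definition nilpotent_subgroups (c : nat) : set (set G) :=
  [set H | subgroup H /\ nilpotent_class_le c H].

Definition exponent_dvd (n : nat) H : Prop := forall x, H x -> x ^+ n = 1.

Definition two_engel : Prop := forall x y : G, [~ x, y, y] = 1.

Definition left_coset (g : G) H : set G := [set g * h | h in H].

Definition left_cosets F : set (set G) :=
  [set A | exists g H, F H /\ A = left_coset g H].

Definition coset_poset F : Type := set_type (left_cosets F).

HB.instance Definition _ F := SubChoice.on (coset_poset F).
(* the order restricted from set G, that is, inclusion of cosets *)
HB.instance Definition _ F :=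
  [SubChoice_isSubPOrder of coset_poset F by <: with set_display].

End Groups.

Section OrderComplex.
Context {d : Order.disp_t} (P : porderType d).

(* A simplex is identified with its set of vertices. *)
Definition order_complex : set (set P) :=
  [set s | [/\ finite_set s, s !=set0 &
             forall x y, s x -> s y -> (x <= y)%O \/ (y <= x)%O]].

End OrderComplex.

Section Realization.
Local Open Scope ring_scope.
Variables (R : realType) (V : choiceType) (K : set (set V)).

(* points in barycentric coordinates *)
Record realization : Type := Realization {
  bary : V -> R;
  bary_ge0 : forall v, 0 <= bary v;
  bary_supp : K [set v | bary v != 0];
  bary_sum : \sum_(v \in [set: V]) bary v = 1 }.

HB.instance Definition _ := gen_eqMixin realization.
HB.instance Definition _ := gen_choiceMixin realization.

Definition closed_simplex (s : set V) : set realization :=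
  [set x | [set v | bary x v != 0] `<=` s].

(* The weak (coherent) topology: U is open iff its trace on every closed
   simplex is. A closed simplex carries the subspace topology of the product
   R^V, which for a finite vertex set s is the Euclidean topology of R^s. *)
Definition realization_open : set_system realization :=
  [set U | forall s, K s ->
     exists2 W : set (prod_topology (fun _ : V => R)), open W &
       closed_simplex s `&` U = closed_simplex s `&` (bary @^-1` W)].

Fact realization_openT : realization_open setT.
Proof. by move=> s _; exists setT; [exact: openT|rewrite preimage_setT]. Qed.

Fact realization_openI : setI_closed realization_open.
Proof.
move=> U1 U2 o1 o2 s Ks; have [W1 oW1 e1] := o1 s Ks.
have [W2 oW2 e2] := o2 s Ks.
exists (W1 `&` W2); first exact: openI.
by rewrite preimage_setI setIIr e1 e2 -setIIr.
Qed.

Fact realization_open_bigU (I : Type) (f : I -> set realization) :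
  (forall i, realization_open (f i)) -> realization_open (\bigcup_i f i).
Proof.
move=> of_ s Ks.
have /choice[W oW] : forall i, exists W : set (prod_topology (fun _ : V => R)),
    open W /\ closed_simplex s `&` f i = closed_simplex s `&` (bary @^-1` W).
  by move=> i; have [W ? ?] := of_ i s Ks; exists W.
exists (\bigcup_i W i); first by apply: bigcup_open => i _; case: (oW i).
rewrite preimage_bigcup !setI_bigcupr.
by apply: eq_bigcupr => i _; case: (oW i).
Qed.

HB.instance Definition _ := isOpenTopological.Build realization
  realization_openT realization_openI realization_open_bigU.

End Realization.

Section Homotopy.
Local Open Scope ring_scope.
Variables (R : realType) (X : topologicalType).

Definition cube (n : nat) : set 'rV[R]_n :=
  [set t | forall i, 0 <= t ord0 i <= 1].

Definition cube_boundary (n : nat) : set 'rV[R]_n :=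
  [set t | cube t /\ exists i, t ord0 i = 0 \/ t ord0 i = 1].

(* maps of pairs (I^n, dI^n) -> (X, x0); values outside I^n are irrelevant *)
Definition spheroid (n : nat) (x0 : X) : set ('rV[R]_n -> X) :=
  [set f | {within @cube n, continuous f} /\
           forall t, cube_boundary t -> f t = x0].

Definition spheroid_homotopic (n : nat) (x0 : X) (f g : 'rV[R]_n -> X) : Prop :=
  exists h : 'rV[R]_n * R -> X,
    [/\ {within @cube n `*` `[0, 1], continuous h},
        forall t, cube t -> h (t, 0) = f t,
        forall t, cube t -> h (t, 1) = g t &
        forall t s, cube_boundary t -> 0 <= s <= 1 -> h (t, s) = x0].

Definition spheroid_class (n : nat) (x0 : X) (f : 'rV[R]_n -> X) :
    set ('rV[R]_n -> X) :=
  [set g | spheroid x0 g /\ spheroid_homotopic x0 f g].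

(* The underlying pointed set of pi_n(X, x0). For n = 0 the cube is a point
   with empty boundary, and this is the set of path components. *)
Definition homotopy_group (n : nat) (x0 : X) : set (set ('rV[R]_n -> X)) :=
  [set spheroid_class x0 f | f in @spheroid n x0].

Definition homotopy_group_trivial (n : nat) (x0 : X) : Prop :=
  @homotopy_group n x0 = [set spheroid_class x0 (cst x0)].

Definition k_connected (k : nat) : Prop :=
  [set: X] !=set0 /\
  forall (i : nat) (x0 : X), (i <= k)%N -> homotopy_group_trivial i x0.

End Homotopy.

Definition coset_complex (R : realType) (G : groupType) (F : set (set G)) :
    topologicalType :=
  realization R (@order_complex _ (coset_poset F)).

(* Main.v *)
(** For class at most 3 the map T(x, y, z) = [x, y, z] is trilinear with values
in the centre and satisfies the Jacobi identity; here 3 T = 0. A coset in the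
poset is a set on which all T(x^-1 y, x^-1 z, x^-1 t) vanish.

Sufficiency. If G has class at most 2 the poset has a greatest element, so its
realization is a cone. If G is 2-Engel, any two elements generate a subgroup of
class at most 2, so an edge loop through cosets with representatives g_i is
contracted to 1 across the cosets <g_i, g_(i+1)>.

Necessity. Choose a representative of every coset. Representatives of a chain
of cosets lie in one coset, so a function of tuples in G that is a cocycle on
every coset is a simplicial cocycle of the order complex. Modulo 3,
c(x, y) = T(x, y, x) + T(x, y, y) is a 1-cocycle, and its sum along the triangle
1, a, b is c(a, b); thus simple connectivity forces c = 0, which is the 2-Engel
identity. If G is 2-Engel, T itself is an alternating 2-cocycle, every three
elements of G lie in a coset, and the sum of T over the boundary of the
tetrahedron 1, a, b, d is T(a, b, d), which therefore vanishes when pi_2 does.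

That these sums are homotopy invariants is proved by discretizing: a null
homotopy is cut into cells so small that each is mapped into the open star of a
vertex, and a discrete Stokes formula is applied to the resulting labels. *)
From HB Require Import structures.
Require Import Defs.
From mathcomp Require Import all_boot all_order all_algebra.
From mathcomp Require Import finmap lra zify.
From mathcomp Require Import all_classical all_reals all_analysis.

Set Implicit Arguments.
Unset Strict Implicit.
Unset Printing Implicit Defensive.

Import Order.TTheory GRing.Theory Num.Theory.
Import numFieldNormedType.Exports.

Local Open Scope classical_set_scope.

(** * Commutators *)

Section Commutators.
Variable G : groupType.
Implicit Types (x y z : G) (A H : set G).
Local Open Scope group_scope.

Lemma subgroup_generated A : subgroup (generated A).
Proof.
split=> [H [[h1 _ _] _]|x y Ax Ay H HH|x Ax H HH]; first exact: h1.
- by have [[_ hM _] _] := HH; apply: hM; [exact: Ax|exact: Ay].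
- by have [[_ _ hV] _] := HH; apply: hV; exact: Ax.
Qed.

Lemma sub_generated A : A `<=` generated A.
Proof. exact: sub_gen_smallest. Qed.

Lemma generated_sub A H : subgroup H -> A `<=` H -> generated A `<=` H.
Proof. by move=> sH AH; exact: smallest_sub. Qed.

Lemma subgroup_centralizer A : subgroup [set z | forall x, A x -> commute z x].
Proof.
split=> [x _|x y cx cy z Az|x cx z Az] /=.
- exact/commute_sym/commute1.
- by apply/commute_sym/commuteM; apply/commute_sym; [exact: cx|exact: cy].
- by apply/commute_sym/commuteV/commute_sym; exact: cx.
Qed.

Lemma commutator_subgroup_mem A H x y : A x -> H y ->
  commutator_subgroup A H [~ x, y].
Proof. by move=> Ax Hy; apply: sub_generated; exists x, y. Qed.

Lemma commutator_subgroup_eq1 A H :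
  (forall x y, A x -> H y -> [~ x, y] = 1) -> commutator_subgroup A H = [set 1].
Proof.
move=> AH; apply/seteqP; split => [|_ ->]; last first.
  by have [] := subgroup_generated [set z | exists x y, [/\ A x, H y & z = [~ x, y]]].
apply: generated_sub => [|_ [x [y [Ax Hy ->]]]]; last exact: AH.
split=> // [x y -> ->|x ->]; first by rewrite mulg1.
by rewrite invg1.
Qed.

(** An element of the commutator subgroup need not be a single commutator. The elements commuting
    with all of [H] form a subgroup, so it is enough to test the generating commutators. *)
Lemma nilpotent_class_le2P H :
  nilpotent_class_le 2 H <->
  (forall x y z, H x -> H y -> H z -> [~ x, y, z] = 1).
Proof.
rewrite /nilpotent_class_le; split=> [e x y z Hx Hy Hz|e].
  have : lower_central H 2 [~ x, y, z] by do 2! apply: commutator_subgroup_mem => //.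
  by rewrite e.
apply: commutator_subgroup_eq1 => x y Hx Hy; apply/eqP/commgP.
suff: [set z | forall x, H x -> commute z x] x by exact.
apply: (generated_sub (subgroup_centralizer H)) Hx => _ [u [v [Hu Hv ->]]] w Hw.
exact/commgP/eqP/e.
Qed.

Lemma nilpotent_class_le3_commg : nilpotent_class_le 3 [set: G] ->
  forall x y z t, [~ x, y, z, t] = 1.
Proof.
rewrite /nilpotent_class_le => e x y z t.
have : lower_central [set: G] 3 [~ x, y, z, t].
  apply: (@commutator_subgroup_mem (lower_central _ 2)) => //.
  apply: (@commutator_subgroup_mem (lower_central _ 1)) => //.
  exact: (@commutator_subgroup_mem (lower_central _ 0)).
by rewrite e.
Qed.

Lemma commMg x y z : [~ x * y, z] = [~ x, z] ^ y * [~ y, z].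
Proof. by rewrite !commgEl !conjgE !invgM !mulgA !(mulgK, mulgVK). Qed.

Lemma commgM x y z : [~ x, y * z] = [~ x, z] * [~ x, y] ^ z.
Proof. by rewrite !commgEl !conjgE !invgM !mulgA !(mulgK, mulgVK). Qed.

Lemma Hall_Witt x y z :
  [~ x, y^-1, z] ^ y * [~ y, z^-1, x] ^ z * [~ z, x^-1, y] ^ x = 1.
Proof.
rewrite !commgEl !conjgE !invgM !invgK !mulgA.
by rewrite !(mulgK, mulgVK) mulVg.
Qed.
End Commutators.

(** * The triple commutator as a trilinear map *)

(** A boolean predicate makes the centre a subtype that carries a [zmodType], where triple
    commutators can be added. *)
Definition center_pred (G : groupType) : pred G :=
  fun z => `[< forall x, commute z x >].

Definition center_type (G : groupType) : Type := {z : G | center_pred z}.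

Section CenterZmodule.
Variable G : groupType.
Local Notation Z := (center_type G).
Local Open Scope group_scope.

HB.instance Definition _ := SubChoice.on Z.

Lemma center_typeP (a : Z) x : commute (val a) x.
Proof. by have /asboolP := valP a; exact. Qed.

Lemma center_pred1 : center_pred (1 : G).
Proof. by apply/asboolP => x; exact/commute_sym/commute1. Qed.

Lemma center_predM (a b : Z) : center_pred (val a * val b).
Proof.
apply/asboolP => x.
by apply/commute_sym/commuteM; apply/commute_sym/center_typeP.
Qed.

Lemma center_predV (a : Z) : center_pred (val a)^-1.
Proof.
by apply/asboolP => x; apply/commute_sym/commuteV/commute_sym/center_typeP.
Qed.

Definition center_zero : Z := exist _ 1 center_pred1.
Definition center_add (a b : Z) : Z := exist _ (val a * val b) (center_predM a b).
Definition center_opp (a : Z) : Z := exist _ (val a)^-1 (center_predV a).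

Fact center_addA : associative center_add.
Proof. by move=> a b c; apply: val_inj; rewrite /= mulgA. Qed.
Fact center_addC : commutative center_add.
Proof. by move=> a b; apply: val_inj; rewrite /= [LHS]center_typeP. Qed.
Fact center_add0 : left_id center_zero center_add.
Proof. by move=> a; apply: val_inj; rewrite /= mul1g. Qed.
Fact center_addN : left_inverse center_zero center_opp center_add.
Proof. by move=> a; apply: val_inj; rewrite /= mulVg. Qed.

HB.instance Definition _ := GRing.isZmodule.Build Z
  center_addA center_addC center_add0 center_addN.
End CenterZmodule.

Section TripleCommutator.
Variable G : groupType.
Implicit Types x y z t : G.
Local Open Scope group_scope.

(** The default 0 makes the map total; under [nil3] all triple commutators are central and the
    default is never taken. *)
Definition triple_commutator x y z : center_type G := insubd (0%R : center_type G) [~ x, y, z].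
Local Notation T := triple_commutator.

Hypothesis nil3 : forall x y z t, [~ x, y, z, t] = 1.

Lemma val_triple x y z : val (T x y z) = [~ x, y, z].
Proof.
rewrite /triple_commutator val_insubd ifT //.
by apply/asboolP => t; apply/commgP/eqP/nil3.
Qed.

Lemma triple_eq0 x y z : (T x y z == 0)%R = ([~ x, y, z] == 1).
Proof. by rewrite -val_eqE /= val_triple. Qed.

Lemma triple_central x y z t : commute [~ x, y, z] t.
Proof. exact/commgP/eqP/nil3. Qed.

Lemma tripleJ x y z t : [~ x, y, z] ^ t = [~ x, y, z].
Proof. exact/conjg_fixP/eqP/nil3. Qed.

Lemma commJ x y t : [~ x, y] ^ t = [~ x, y] * [~ x, y, t].
Proof. by rewrite (commgEl [~ x, y]) mulVKg. Qed.

(* conjugating a commutator only changes it by a central factor *)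
Lemma tripleJl x y t z : [~ [~ x, y] ^ t, z] = [~ x, y, z].
Proof. by rewrite commJ commMg tripleJ nil3 mulg1. Qed.

(** Expanding commutators of products produces conjugates, which have no effect: on an inner
    commutator by [tripleJl], on a central value by [tripleJ]. *)
Lemma tripleDl x x' y z : T (x * x') y z = (T x y z + T x' y z)%R.
Proof.
apply: val_inj; rewrite /= !val_triple commMg.
by rewrite commMg tripleJl tripleJ.
Qed.

Lemma tripleDm x y y' z : T x (y * y') z = (T x y z + T x y' z)%R.
Proof.
apply: val_inj; rewrite /= !val_triple commgM.
by rewrite commMg tripleJ tripleJl triple_central.
Qed.

Lemma tripleDr x y z z' : T x y (z * z') = (T x y z + T x y z')%R.
Proof.
by apply: val_inj; rewrite /= !val_triple commgM tripleJ triple_central.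
Qed.

Lemma triplexx x z : T x x z = 0%R.
Proof. by apply/eqP; rewrite triple_eq0 commgg comm1g. Qed.

Lemma triple1l y z : T 1 y z = 0%R.
Proof. by apply/eqP; rewrite triple_eq0 !comm1g. Qed.

Lemma triple1m x z : T x 1 z = 0%R.
Proof. by apply/eqP; rewrite triple_eq0 commg1 comm1g. Qed.

Lemma triple1r x y : T x y 1 = 0%R.
Proof. by apply/eqP; rewrite triple_eq0 commg1. Qed.

(** Polarization of [T (x * y) (x * y) z = 0]. *)
Lemma tripleC x y z : T x y z = (- T y x z)%R.
Proof.
apply/eqP; rewrite -addr_eq0; apply/eqP.
have := triplexx (x * y) z.
by rewrite tripleDl !tripleDm !triplexx add0r addr0.
Qed.

Lemma tripleNl x y z : T x^-1 y z = (- T x y z)%R.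
Proof.
by apply/eqP; rewrite -addr_eq0 -tripleDl mulVg triple1l.
Qed.

Lemma tripleNm x y z : T x y^-1 z = (- T x y z)%R.
Proof.
by apply/eqP; rewrite -addr_eq0 -tripleDm mulVg triple1m.
Qed.

Lemma tripleNr x y z : T x y z^-1 = (- T x y z)%R.
Proof.
by apply/eqP; rewrite -addr_eq0 -tripleDr mulVg triple1r.
Qed.

(** This is the Hall-Witt identity: its conjugations fix central elements, and its inverses
    contribute one common sign. *)
Lemma triple_Jacobi x y z : (T x y z + T y z x + T z x y = 0)%R.
Proof.
have : (T x y^-1 z + T y z^-1 x + T z x^-1 y = 0)%R.
  by apply: val_inj; rewrite /= !val_triple -[RHS](Hall_Witt x y z) !tripleJ.
by rewrite !tripleNm -!opprD => /eqP; rewrite oppr_eq0 => /eqP.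
Qed.

Hypothesis exp3 : forall x y z, [~ x, y, z] ^+ 3 = 1.

Lemma triple_exp3 x y z : (T x y z *+ 3 = 0)%R.
Proof.
by apply: val_inj; rewrite /= val_triple; exact: exp3.
Qed.

End TripleCommutator.

(** * A reflexive decision procedure for equalities in abelian groups *)

Inductive zmod_expr :=
  | ZVar of nat | ZZero | ZAdd of zmod_expr & zmod_expr | ZOpp of zmod_expr.

Section ZmodReflection.
Local Open Scope ring_scope.

Fixpoint zmod_eval (A : zmodType) (env : seq A) e : A :=
  match e with
  | ZVar i => nth 0 env i
  | ZZero => 0
  | ZAdd e1 e2 => zmod_eval env e1 + zmod_eval env e2
  | ZOpp e1 => - zmod_eval env e1
  end.

Fixpoint zmod_coef e (i : nat) : int :=
  match e with
  | ZVar j => (i == j)%:Z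
  | ZZero => 0
  | ZAdd e1 e2 => zmod_coef e1 i + zmod_coef e2 i
  | ZOpp e1 => - zmod_coef e1 i
  end.

Lemma zmod_evalE (A : zmodType) (env : seq A) e :
  zmod_eval env e = \sum_(i < size env) nth 0 env i *~ zmod_coef e i.
Proof.
elim: e => [j||e1 IH1 e2 IH2|e1 IH1] /=.
- have [jn|nj] := ltnP j (size env).
    rewrite (bigD1 (Ordinal jn)) //= eqxx mulr1z big1 ?addr0 // => i ij.
    by rewrite -[(_ == _ :> nat)]/(i == Ordinal jn) (negbTE ij) mulr0z.
  rewrite nth_default // big1 // => i _.
  by rewrite ltn_eqF ?mulr0z //; exact: leq_trans (ltn_ord i) nj.
- by rewrite big1 // => i _; rewrite mulr0z.
- by rewrite IH1 IH2 -big_split; apply: eq_bigr => i _; rewrite mulrzDr.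
- by rewrite IH1 -sumrN; apply: eq_bigr => i _; rewrite mulrNz.
Qed.

Lemma zmod_eq_reflect (A : zmodType) (env : seq A) e1 e2 :
  all (fun i => zmod_coef e1 i == zmod_coef e2 i) (iota 0 (size env)) ->
  zmod_eval env e1 = zmod_eval env e2.
Proof.
move=> /allP e12; rewrite !zmod_evalE; apply: eq_bigr => i _.
by rewrite (eqP (e12 i _)) // mem_iota /=.
Qed.
End ZmodReflection.

Ltac zmod_insert a env :=
  lazymatch env with
  | context [cons a _] => env
  | _ => constr:(cons a env)
  end.

Ltac zmod_atoms t env :=
  lazymatch t with
  | GRing.zero => env
  | GRing.add ?a ?b => let env := zmod_atoms a env in zmod_atoms b env
  | GRing.opp ?a => zmod_atoms a env
  | _ => zmod_insert t env
  end.

Ltac zmod_index a env :=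
  lazymatch env with
  | cons a _ => constr:(0%N)
  | cons _ ?env => let i := zmod_index a env in constr:(S i)
  end.

Ltac zmod_reify t env :=
  lazymatch t with
  | GRing.zero => constr:(ZZero)
  | GRing.add ?a ?b =>
    let ea := zmod_reify a env in let eb := zmod_reify b env in
    constr:(ZAdd ea eb)
  | GRing.opp ?a => let ea := zmod_reify a env in constr:(ZOpp ea)
  | _ => let i := zmod_index t env in constr:(ZVar i)
  end.

Ltac zmod_eq :=
  lazymatch goal with
  | |- @eq ?A ?l ?r =>
    let env := zmod_atoms l (@nil A) in
    let env := zmod_atoms r env in
    let el := zmod_reify l env in
    let er := zmod_reify r env in
    exact: (@zmod_eq_reflect _ env el er isT)
  end.

(** * Cocycles on cosets and a discrete Stokes formula *)

Section Cocycles.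
Variable G : groupType.
Implicit Types (x y z t : G) (D : set G).
Local Open Scope group_scope.
Hypothesis nil3 : forall x y z t, [~ x, y, z, t] = 1.
Local Notation T := (@triple_commutator G).
Local Notation F := (@nilpotent_subgroups G 2).

Lemma left_coset_mulV x y D : left_cosets F D -> D x -> D y ->
  exists2 H, F H & H (x^-1 * y) /\ D = left_coset x H.
Proof.
move=> [g [H [FH ->]]] [h Hh <-] [k Hk <-]; exists H => //.
have [[H1 HM HV] _] := FH.
split; first by rewrite invgM -mulgA mulKg; apply: HM => //; exact: HV.
apply/seteqP; split=> _ [l Hl <-].
  by exists (h^-1 * l); [apply: HM => //; exact: HV|rewrite mulgA mulgK].
by exists (h * l); [exact: HM|rewrite mulgA].
Qed.

Lemma triple_coset D o x y z : left_cosets F D -> D o -> D x -> D y -> D z ->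
  T (o^-1 * x) (o^-1 * y) (o^-1 * z) = 0%R.
Proof.
move=> FD Do Dx Dy Dz; apply/eqP; rewrite triple_eq0 //; apply/eqP.
have [H [[H1 HM HV] nH] [_ DE]] := left_coset_mulV FD Do Dx.
have DH u : D u -> H (o^-1 * u) by rewrite DE => -[k Hk <-]; rewrite mulKg.
by move/nilpotent_class_le2P : nH; apply; exact: DH.
Qed.

Definition engel_cochain x y : center_type G := (T x y x + T x y y)%R.

Hypothesis exp3 : forall x y z, [~ x, y, z] ^+ 3 = 1.

(* modulo the Jacobi identity the coboundary is 3 [x^-1 y, x^-1 z, x] *)
Lemma engel_cochainD D x y z : left_cosets F D -> D x -> D y -> D z ->
  (engel_cochain x y + engel_cochain y z = engel_cochain x z)%R.
Proof.
move=> FD Dx.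
rewrite -[y](mulVKg x) -[z](mulVKg x); move: (x^-1 * y) (x^-1 * z) => k l Dk Dl.
have klk := triple_coset FD Dx Dk Dl Dk; have kll := triple_coset FD Dx Dk Dl Dl.
rewrite !mulKg in klk kll.
have J := triple_Jacobi nil3 x k l.
have E : (T k l x + T k l x + T k l x = 0)%R.
  by rewrite -[RHS](triple_exp3 nil3 exp3 k l x) -addrA.
rewrite /engel_cochain !(tripleDl nil3, tripleDm nil3, tripleDr nil3) !triplexx //.
rewrite !(tripleC nil3 k x) klk kll.
rewrite (tripleC nil3 l x) in J.
(* Once the zero elements 3 T(k, l, x) and the Jacobi sum are added and subtracted on the right, the
   equality holds formally in the atoms. *)
rewrite -[RHS]addr0 -[X in _ = (_ + X)%R]E -[RHS]subr0 -[X in _ = (_ - X)%R]J.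
zmod_eq.
Qed.

Lemma engel_cochain1l y : engel_cochain 1 y = 0%R.
Proof. by rewrite /engel_cochain !triple1l // addr0. Qed.

Lemma engel_cochain1r x : engel_cochain x 1 = 0%R.
Proof. by rewrite /engel_cochain !triple1m // addr0. Qed.

(** Adding the identities for [y] and [y^-1] gives 2 T(x, y, y) = 0, and 3 T = 0 concludes. *)
Lemma engel_cochain_eq0 : (forall x y, engel_cochain x y = 0%R) -> two_engel G.
Proof.
move=> e x y; apply/eqP; rewrite -triple_eq0 //; apply/eqP.
have := e x y; have := e x y^-1.
rewrite /engel_cochain !(tripleNm nil3) !(tripleNr nil3) opprK => e1 e2.
have e3 := triple_exp3 nil3 exp3 x y y.
rewrite -[RHS]subr0 -[X in _ = (_ - X)%R]e1 -[RHS]subr0 -[X in _ = (_ - X)%R]e2.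
rewrite -[RHS]addr0 -[X in _ = (_ + X)%R]e3 !mulrS mulr0n.
zmod_eq.
Qed.

Hypothesis engelG : two_engel G.

Lemma triplexyy x y : T x y y = 0%R.
Proof. by apply/eqP; rewrite triple_eq0 // engelG. Qed.

Lemma tripleCr x y z : T x y z = (- T x z y)%R.
Proof.
apply/eqP; rewrite -addr_eq0; apply/eqP.
have := triplexyy x (y * z).
by rewrite tripleDm // !tripleDr // !triplexyy add0r addr0.
Qed.

Lemma triple_rot x y z : T x y z = T z x y.
Proof. by rewrite tripleCr tripleC // opprK. Qed.

Lemma triplexyx x y : T x y x = 0%R.
Proof. by rewrite triple_rot triplexx. Qed.

(** The primitive is the cone with apex [o]. When T is expanded around [o], the term in the three
    differences vanishes on the coset and the terms containing [o] twice vanish because T is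
    alternating. *)
Lemma triple_coboundary D o x y z : left_cosets F D -> D o -> D x -> D y -> D z ->
  (T x y z = T o x y + T o y z - T o x z)%R.
Proof.
move=> FD Do.
rewrite -[x](mulVKg o) -[y](mulVKg o) -[z](mulVKg o).
move: (o^-1 * x) (o^-1 * y) (o^-1 * z) => k l m Dk Dl Dm.
have klm := triple_coset FD Do Dk Dl Dm; rewrite !mulKg in klm.
rewrite !(tripleDl nil3, tripleDm nil3, tripleDr nil3) !triplexx // klm.
rewrite !triplexyx !(tripleC nil3 k o) triplexyx (triple_rot k l o).
zmod_eq.
Qed.

End Cocycles.

(** * Discrete Stokes formulas on grids *)

Section DiscreteStokes.
Variables (A : zmodType) (S : Type).
Local Open Scope ring_scope.

(** A repeated index contributes zero, so a sum over a refined grid collapses to the sum over the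
    coarse one. *)
Lemma sum_monotone_steps (f : nat -> nat -> A) (u : nat -> nat) n :
  (forall a, f a a = 0) ->
  (forall i, (i < n)%N -> u i.+1 = u i \/ u i.+1 = (u i).+1) -> u 0 = 0%N ->
  \sum_(0 <= i < n) f (u i) (u i.+1) = \sum_(0 <= a < u n) f a a.+1.
Proof.
move=> f0 + u0; elim: n => [|n IH] un; first by rewrite u0 !big_geq.
rewrite big_nat_recr //= IH => [|i iln]; last by apply: un; exact: ltnW.
have [->|->] := un n (ltnSn n); first by rewrite f0 addr0.
by rewrite [RHS]big_nat_recr.
Qed.

(** By the cell identity, the sums of consecutive rows differ by a telescoping sum of vertical
    edges, whose end terms lie on the sides, where [phi] is constant. The last row is constant and
    sums to zero. *)
Lemma stokes_square (c : S -> S -> A) (phi : nat -> nat -> S) (e : S) n m :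
  c e e = 0 ->
  (forall i j, (i < n)%N -> (j < m)%N ->
    c (phi i j) (phi i.+1 j) + c (phi i.+1 j) (phi i.+1 j.+1) =
    c (phi i j) (phi i j.+1) + c (phi i j.+1) (phi i.+1 j.+1)) ->
  (forall j, (j <= m)%N -> phi 0%N j = e) ->
  (forall j, (j <= m)%N -> phi n j = e) ->
  (forall i, (i <= n)%N -> phi i m = e) ->
  \sum_(0 <= i < n) c (phi i 0%N) (phi i.+1 0%N) = 0.
Proof.
move=> c0 cphi phi0 phin phim.
suff step j : (j <= m)%N ->
    \sum_(0 <= i < n) c (phi i (m - j)%N) (phi i.+1 (m - j)%N) = 0.
  by have := step m (leqnn m); rewrite subnn.
elim: j => [_|j IH jm].
  by rewrite subn0 big_nat big1 // => i /andP[_ ilen]; rewrite !phim // ltnW.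
set k := (m - j.+1)%N; have km : (k < m)%N by rewrite /k ltn_subrL (leq_trans _ jm).
have kE : k.+1 = (m - j)%N by rewrite /k subnSK.
rewrite -[RHS](IH (ltnW jm)) -kE; apply/eqP; rewrite -subr_eq0 -sumrB.
rewrite (@eq_big_nat _ _ _ _ _ _ (fun i =>
    - (c (phi i.+1 k) (phi i.+1 k.+1) - c (phi i k) (phi i k.+1)))); last first.
  move=> i /andP[_ iln]; rewrite -[X in X - _ = _](addrK (c (phi i.+1 k) (phi i.+1 k.+1))).
  rewrite (cphi i k iln km); zmod_eq.
rewrite sumrN telescope_sumr // !phi0 ?phin ?c0 ?subrr ?oppr0 //; exact: ltnW.
Qed.

(** The square is cut along the diagonal from [x00] to [x11]; the two triangles enter with opposite
    signs. *)
Definition square_cochain (c : S -> S -> S -> A) (x00 x10 x01 x11 : S) : A :=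
  c x00 x10 x11 - c x00 x01 x11.

Variable c : S -> S -> S -> A.
Local Notation sq := (square_cochain c).

(** The six faces, grouped in opposite pairs, form a closed surface, on which the edge contributions
    of [b] cancel. *)
Lemma square_cochain_cube (P : S -> Prop) (b : S -> S -> A)
    (x000 x100 x010 x110 x001 x101 x011 x111 : S) :
  (forall x y z, P x -> P y -> P z -> c x y z = b x y + b y z - b x z) ->
  P x000 -> P x100 -> P x010 -> P x110 -> P x001 -> P x101 -> P x011 -> P x111 ->
  sq x000 x100 x010 x110 - sq x001 x101 x011 x111 =
  (sq x000 x100 x001 x101 - sq x010 x110 x011 x111) -
  (sq x000 x010 x001 x011 - sq x100 x110 x101 x111).
Proof.
move=> cb *; rewrite /square_cochain !cb //.
zmod_eq.
Qed.

(** Consecutive layers have equal sums because the lateral faces telescope to sides where [phi] is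
    constant. The primitive [b] may change from cell to cell. *)
Lemma stokes_cube (phi : nat -> nat -> nat -> S) (e : S) n m :
  c e e e = 0 ->
  (forall i j k, (i < n)%N -> (j < n)%N -> (k < m)%N ->
    exists (P : S -> Prop) (b : S -> S -> A),
      (forall x y z, P x -> P y -> P z -> c x y z = b x y + b y z - b x z) /\
      (forall i' j' k', (i' <= 1)%N -> (j' <= 1)%N -> (k' <= 1)%N ->
         P (phi (i' + i)%N (j' + j)%N (k' + k)%N))) ->
  (forall j k, (j <= n)%N -> (k <= m)%N -> phi 0%N j k = e) ->
  (forall j k, (j <= n)%N -> (k <= m)%N -> phi n j k = e) ->
  (forall i k, (i <= n)%N -> (k <= m)%N -> phi i 0%N k = e) ->
  (forall i k, (i <= n)%N -> (k <= m)%N -> phi i n k = e) ->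
  (forall i j, (i <= n)%N -> (j <= n)%N -> phi i j m = e) ->
  \sum_(0 <= i < n) \sum_(0 <= j < n)
    sq (phi i j 0%N) (phi i.+1 j 0%N) (phi i j.+1 0%N) (phi i.+1 j.+1 0%N) = 0.
Proof.
move=> c0 cphi p0 pn q0 qn pm.
have sq0 : sq e e e e = 0 by rewrite /square_cochain c0 subrr.
pose s k := \sum_(0 <= i < n) \sum_(0 <= j < n)
    sq (phi i j k) (phi i.+1 j k) (phi i j.+1 k) (phi i.+1 j.+1 k).
rewrite -[LHS]/(s 0%N).
have sm : s m = 0.
  rewrite /s big_nat big1 // => i /andP[_ iln]; rewrite big_nat big1 // => j /andP[_ jln].
  by rewrite !pm ?sq0 // ltnW.
have sS k : (k < m)%N -> s k = s k.+1.
  move=> km; apply/eqP; rewrite -subr_eq0 /s -sumrB.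
  pose xz i j := sq (phi i j k) (phi i.+1 j k) (phi i j k.+1) (phi i.+1 j k.+1).
  pose yz i j := sq (phi i j k) (phi i j.+1 k) (phi i j k.+1) (phi i j.+1 k.+1).
  (* For fixed [i] the faces [xz] telescope in [j]; the faces [yz] telescope in [i] after the sums
     are exchanged below. *)
  rewrite (@eq_big_nat _ _ _ _ _ _ (fun i => - (xz i n - xz i 0%N) +
     \sum_(0 <= j < n) (yz i.+1 j - yz i j))); last first.
    move=> i /andP[_ iln]; rewrite -sumrB -telescope_sumr // -sumrN -big_split /=.
    apply: eq_big_nat => j /andP[_ jln].
    have [P [b [cb Pphi]]] := cphi i j k iln jln km.
    rewrite (square_cochain_cube cb) /xz /yz; last exact: (Pphi 1 1 1)%N.
    - zmod_eq.
    - exact: (Pphi 0 0 0)%N.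
    - exact: (Pphi 1 0 0)%N.
    - exact: (Pphi 0 1 0)%N.
    - exact: (Pphi 1 1 0)%N.
    - exact: (Pphi 0 0 1)%N.
    - exact: (Pphi 1 0 1)%N.
    - exact: (Pphi 0 1 1)%N.
  rewrite big_split /= big_nat big1 ?add0r => [|i /andP[_ iln]]; last first.
    by rewrite /xz !qn ?q0 ?sq0 ?subrr ?oppr0 // ltnW.
  rewrite exchange_big /= big_nat big1 // => j /andP[_ jln].
  by rewrite telescope_sumr // /yz !p0 ?pn ?sq0 ?subrr // ltnW.
have sj j : (j <= m)%N -> s j = 0.
  elim/ltn_ind: {j}(m - j)%N {-2}j (erefl (m - j)%N) => d IH j dE.
  rewrite leq_eqVlt => /orP[/eqP -> //|jm].
  by rewrite sS //; apply: (IH (m - j.+1)%N) => //; rewrite -dE ltn_sub2l.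
exact: sj.
Qed.

(** A repeated row or column gives a square with two degenerate triangles. The rows are collapsed
    first, then the columns. *)
Lemma square_sum_monotone_steps (w : nat -> nat -> S) (u : nat -> nat) n :
  (forall x y, c x x y = 0) -> (forall x y, c x y y = 0) ->
  (forall i, (i < n)%N -> u i.+1 = u i \/ u i.+1 = (u i).+1) -> u 0 = 0%N ->
  \sum_(0 <= i < n) \sum_(0 <= j < n)
    sq (w (u i) (u j)) (w (u i.+1) (u j)) (w (u i) (u j.+1)) (w (u i.+1) (u j.+1)) =
  \sum_(0 <= a < u n) \sum_(0 <= b < u n)
    sq (w a b) (w a.+1 b) (w a b.+1) (w a.+1 b.+1).
Proof.
move=> cl cr un u0.
pose f a a' := \sum_(0 <= j < n)
  sq (w a (u j)) (w a' (u j)) (w a (u j.+1)) (w a' (u j.+1)).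
have -> := @sum_monotone_steps f u n _ un u0; last first.
  by move=> a; rewrite /f big1 // => j _; rewrite /square_cochain cl cr subrr.
apply: eq_bigr => a _; rewrite /f.
pose g b b' := sq (w a b) (w a.+1 b) (w a b') (w a.+1 b').
apply: (@sum_monotone_steps g u n _ un u0) => b.
by rewrite /g /square_cochain cl cr subrr.
Qed.
End DiscreteStokes.

(** * Topology of the realization *)

Section RealizationTopology.
Variables (R : realType) (V : choiceType) (K : set (set V)).
Local Notation X := (realization R K).
Local Open Scope ring_scope.

Definition support (x : X) : set V := [set v | bary x v != 0].

Lemma bary_inj (x y : X) : bary x =1 bary y -> x = y.
Proof.
case: x y => [b b0 bK b1] [b' b'0 b'K b'1] /= /funext bb'; subst b'.
by congr Realization; exact: Prop_irrelevance.
Qed.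

Lemma realization_openP (U : set X) : open U = realization_open U.
Proof. by []. Qed.

Lemma bary_continuous (v : V) : continuous (fun x : X => bary x v).
Proof.
apply/continuousP => O oO; rewrite realization_openP => s Ks.
exists ((proj v : prod_topology (fun=> R) -> R) @^-1` O) => //.
have /continuousP/(_ O oO) :
  continuous (proj v : prod_topology (fun=> R : topologicalType) -> R).
  exact: (@proj_continuous V (fun=> R : topologicalType)).
by [].
Qed.

Lemma open_star (v : V) : open [set x : X | bary x v != 0].
Proof.
apply: ((continuousP _).1 (@bary_continuous v) [set r : R | r != 0]).
exact: open_neq.
Qed.

Hypothesis Kfin : forall s, K s -> finite_set s.

Lemma finite_support_bary (x : X) : finite_set (support x).
Proof. by case: x => b b0 bK b1; exact: Kfin. Qed.

Lemma finite_powerset (s : set V) : finite_set s -> finite_set [set t | t `<=` s].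
Proof.
move=> /finite_fsetP[S ->].
apply: (@sub_finite_set _ _ ((fun t : {fset V} => [set` t]) @` [set` fpowerset S])).
  move=> t tS; exists [fset x in S | x \in t]%fset.
    by rewrite /= fpowersetE; apply/fsubsetP => x; rewrite !inE => /andP[].
  apply/seteqP; split => x /=; rewrite !inE; first by move=> /andP[_ /set_mem].
  by move=> tx; rewrite (tS _ tx) mem_set.
exact/finite_image/finite_fset.
Qed.

(* Choosing one point for each support that occurs in A gives a set all of
   whose subsets are closed, since a closed simplex contains only finitely many
   of them; being compact and discrete it is finite. *)
Lemma compact_support (A : set X) : compact A ->
  finite_set (\bigcup_(x in A) support x).
Proof.
move=> cA.
pose E : set (set V) := [set support x | x in A].
have Efin : finite_set E -> finite_set (\bigcup_(x in A) support x).
  move=> fE; rewrite (_ : \bigcup_(x in A) _ = \bigcup_(s in E) s); last first.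
    by rewrite bigcup_image.
  apply: bigcup_finite => // _ [x _ <-]; exact: finite_support_bary.
apply: Efin.
have [A0|/set0P[x0 Ax0]] := eqVneq A set0.
  by rewrite /E A0 image_set0; exact: finite_set0.
have /choice[pt ptE] : forall s : set V, exists x : X,
    E s -> A x /\ support x = s.
  move=> s; have [[x Ax <-]|nE] := pselect (E s); first by exists x.
  by exists x0.
have opt (P : set (set V)) : P `<=` E -> open (~` (pt @` P)).
  move=> PE; rewrite realization_openP => s Ks.
  pose Q := (fun t => bary (pt t)) @` (P `&` [set t | t `<=` s]).
  exists (~` Q).
    rewrite openC.
    have /accessible_finite_set_closed h :
        accessible_space (prod_topology (fun _ : V => R : topologicalType)).
      apply: hausdorff_accessible.
      by apply: (@hausdorff_product V (fun=> R : topologicalType)) => _; exact: Rhausdorff.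
    apply: h.
    by apply/finite_image/finite_setIr/finite_powerset/Kfin.
  apply/seteqP; split=> x [sx xn]; split=> //.
    by move=> [t [Pt ts] tx]; apply: xn; exists t => //; apply: bary_inj => v; rewrite tx.
  move=> [t Pt tx]; apply: xn; exists t; last by rewrite tx.
  by split=> //= v; have [_ <-] := ptE t (PE _ Pt); rewrite tx; exact: sx.
(* [F] is the filter of sets cofinite in [E]. Compactness in its near-covering form shows that, for
   all but finitely many [s] in [E], no point of [A] equals [pt s]; yet [pt s] is in [A] whenever
   [s] is in [E]. *)
pose F : set_system (set V) := [set B | finite_set (E `\` B)].
have FF : Filter F.
  split=> [|B C FB FC|B C BC]; rewrite /F /=.
  - by rewrite setDT; exact: finite_set0.
  - by rewrite setDIr finite_setU.
  - by apply: sub_finite_set; exact: setDS.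
have : F [set s | A `<=` (fun x => E s -> x <> pt s)].
  apply: ((compact_near_coveringP A).1 cA _ F (fun s x => E s -> x <> pt s) FF).
  move=> x Ax; exists (~` (pt @` (E `\ support x)), ~` [set support x]).
    split; last first.
      by apply: sub_finite_set (finite_set1 (support x)) => s [_ /contrapT].
    apply: open_nbhs_nbhs; split; first by apply: opt => t [].
    by move=> [t [Et tx] ptx]; apply: tx; rewrite /= -ptx; have [_ ->] := ptE t Et.
  by move=> [y s] [/= ny ns] Es ys; apply: ny; exists s.
rewrite /F /=; apply: sub_finite_set => s Es; split => // As.
by have [/As/(_ Es)] := ptE s Es.
Qed.

(* On a finite set of vertices there are finitely many possible supports, and
   the support of a point can only grow nearby. *)
Lemma realization_continuous_within (Y : topologicalType) (A : set Y)
    (f : Y -> X) (S : set V) : finite_set S ->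
  (forall y, A y -> support (f y) `<=` S) ->
  (forall v, {within A, continuous (fun y => bary (f y) v)}) ->
  {within A, continuous f}.
Proof.
move=> Sfin fS bf; apply/subspace_continuousP => y0 Ay0 U.
rewrite nbhsE => -[Q [oQ Qy0] QU]; apply: (@filterS _ _ _ (f @^-1` Q)).
  by move=> y; exact: QU.
pose g y : prod_topology (fun _ : V => R : topologicalType) := bary (f y).
have bf0 : g @ within A (nbhs y0) --> g y0.
  apply/cvg_sup => v; apply/cvg_image.
    by apply/seteqP; split=> // r _; exists (fun=> r).
  move=> B nB; have /subspace_continuousP/(_ y0 Ay0 B nB) := bf v.
  rewrite /= => h; exists ((fun k : V -> R => k v) @^-1` B) => //.
  by apply/seteqP; split=> [r [k Bk <-//]|r Br]; exists (fun=> r).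
have near_supp v : bary (f y0) v != 0 ->
    \forall y \near within A (nbhs y0), bary (f y) v != 0.
  move=> v0; have /subspace_continuousP/(_ y0 Ay0 [set r | r != 0]) := bf v; apply.
  by apply: open_nbhs_nbhs; split => //; exact: open_neq.
have near_all (T : eqType) (L : seq T) (P : T -> Y -> Prop) :
    (forall t, t \in L -> \forall y \near within A (nbhs y0), P t y) ->
    \forall y \near within A (nbhs y0), forall t, t \in L -> P t y.
  elim: L => [|t L IH] LP; first by apply: filterE.
  have Pt := LP t (mem_head _ _).
  have PL : \forall y \near within A (nbhs y0), forall t, t \in L -> P t y.
    by apply: IH => u uL; apply: LP; rewrite inE uL orbT.
  near=> y => u; rewrite inE => /orP[/eqP ->|uL].
    by near: y.
  by move: u uL; near: y.
have /finite_fsetP[S0 S0E] := finite_support_bary (f y0).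
have /finite_fsetP[L LE] := finite_powerset Sfin.
have h1 : \forall y \near within A (nbhs y0), forall v, v \in S0 -> bary (f y) v != 0.
  apply: near_all => v vS0; apply: near_supp.
  by have : [set` S0] v by []; rewrite -S0E.
have h2 : \forall y \near within A (nbhs y0), forall s, s \in L ->
    support (f y0) `<=` s -> support (f y) = s -> Q (f y).
  apply: near_all => s sL.
  have [[Ks y0s]|ns] := pselect (K s /\ support (f y0) `<=` s); last first.
    apply: filterE => y y0s ys; exfalso; apply: ns; split => //.
    by rewrite -ys; case: (f y).
  move: oQ; rewrite realization_openP => /(_ s Ks)[W oW WE].
  have Wy0 : W (bary (f y0)).
    have : (@closed_simplex R V K s `&` Q) (f y0) by split.
    by rewrite WE => -[].
  have := bf0 W; rewrite /= => /(_ (open_nbhs_nbhs (conj oW Wy0))) nW.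
  near=> y => _ ys.
  have : (@closed_simplex R V K s `&` (@bary R V K) @^-1` W) (f y).
    split; first by rewrite -ys.
    by near: y.
  by rewrite -WE => -[].
have h3 : \forall y \near within A (nbhs y0), A y by exact: withinT.
near=> y; rewrite /=.
have Ay : A y by near: y.
have fy0 : support (f y0) `<=` support (f y).
  rewrite S0E => v; move: v; near: y; exact: h1.
have fyL : support (f y) \in L.
  have : [set t | t `<=` S] (support (f y)) by exact: fS.
  by rewrite LE.
have H : forall s, s \in L -> support (f y0) `<=` s -> support (f y) = s -> Q (f y).
  by near: y.
exact: (H (support (f y))).
Unshelve. all: by end_near. Qed.
End RealizationTopology.

(** * Convex combinations in an order complex *)

Section ConvexCombinations.
Context (R : realType) {d : Order.disp_t} (P : porderType d).
Local Notation K := (@order_complex d P).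
Local Notation X := (realization R K).
Local Open Scope ring_scope.

Definition comparable_verts (v w : P) : Prop := (v <= w)%O \/ (w <= v)%O.

Lemma comparable_verts_refl v : comparable_verts v v.
Proof. by left. Qed.

Lemma comparable_verts_sym v w : comparable_verts v w -> comparable_verts w v.
Proof. by case; [right|left]. Qed.

Lemma order_complex_finite s : K s -> finite_set s.
Proof. by case. Qed.

Lemma support_comparable (x : X) v w :
  support x v -> support x w -> comparable_verts v w.
Proof. by have [_ _ h] := bary_supp x; exact: h. Qed.

Lemma support_neq0 (x : X) : support x !=set0.
Proof. by have [_ h _] := bary_supp x. Qed.

Lemma bary_sum_fset (x : X) (A : {fset P}) : support x `<=` [set` A] ->
  \sum_(v <- A) bary x v = 1.
Proof.
move=> xA; rewrite -(bary_sum x) (fsbigTE A) // => v vA.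
by apply/eqP; apply: contraNT vA => /xA.
Qed.

Fact vertex_ge0 (v w : P) : 0 <= (w == v)%:R :> R. Proof. by []. Qed.

Fact vertex_supp (v : P) : K [set w | (w == v)%:R != 0 :> R].
Proof.
rewrite (_ : mkset _ = [set v]); last first.
  apply/seteqP; split=> w /=; first by case: (eqVneq w v) => // _; rewrite /= mulr0n eqxx.
  by move=> ->; rewrite eqxx oner_eq0.
by split => [||w w' -> ->]; [exact: finite_set1|exists v|left].
Qed.

Fact vertex_sum (v : P) : \sum_(w \in [set: P]) ((w == v)%:R : R) = 1.
Proof.
rewrite (fsbigTE [fset v]%fset) => [|w]; first by rewrite big_seq_fset1 eqxx.
by rewrite inE => /negbTE ->.
Qed.

Definition vertex (v : P) : X :=
  Realization (vertex_ge0 v) (vertex_supp v) (vertex_sum v).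

Lemma support_vertex v w : support (vertex v) w -> w = v.
Proof.
by rewrite /support /=; case: (eqVneq w v) => // _; rewrite /= mulr0n eqxx.
Qed.

Lemma support_vertex_refl v : support (vertex v) v.
Proof. by rewrite /support /= eqxx oner_eq0. Qed.

(** Comparability is required only between points of nonzero weight: it makes the union of their
    supports a chain, hence a simplex. *)
Definition convex_valid (I : finType) (a : I -> R) (x : I -> X) : Prop :=
  [/\ forall i, 0 <= a i, \sum_i a i = 1 &
      forall i j v w, a i != 0 -> a j != 0 -> support (x i) v ->
        support (x j) w -> comparable_verts v w].

Definition convex_bary (I : finType) (a : I -> R) (x : I -> X) (v : P) : R :=
  \sum_i a i * bary (x i) v.

Lemma convex_bary_ge0 (I : finType) (a : I -> R) (x : I -> X) v :
  (forall i, 0 <= a i) -> 0 <= convex_bary a x v.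
Proof. by move=> a0; apply: sumr_ge0 => i _; rewrite mulr_ge0 ?bary_ge0. Qed.

Lemma convex_bary_neq0 (I : finType) (a : I -> R) (x : I -> X) v :
  (forall i, 0 <= a i) ->
  convex_bary a x v != 0 <-> exists2 i, a i != 0 & support (x i) v.
Proof.
move=> a0; have ge0 i : true -> 0 <= a i * bary (x i) v.
  by rewrite mulr_ge0 ?bary_ge0.
rewrite /convex_bary psumr_neq0 //; split => [/hasP[i _ /=]|[i ai xi]].
  by rewrite lt_neqAle ge0 // andbT eq_sym mulf_eq0 negb_or => /andP[]; exists i.
apply/hasP; exists i; first by rewrite mem_index_enum.
by rewrite /= lt_neqAle ge0 // andbT eq_sym mulf_neq0.
Qed.

Section ConvexValid.
Variables (I : finType) (a : I -> R) (x : I -> X).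
Hypothesis ax : convex_valid a x.

Let a0 i : 0 <= a i. Proof. by case: ax. Qed.

Fact convex_supp : K [set v | convex_bary a x v != 0].
Proof.
have [_ a1 cmp] := ax; split.
- apply: (@sub_finite_set _ _ (\bigcup_(i in [set: I]) support (x i))).
    by move=> v /convex_bary_neq0[] // i _ xiv; exists i.
  apply: bigcup_finite => [|i _]; first exact: finite_finset.
  exact/finite_support_bary/order_complex_finite.
- have [i ai] : exists i, a i != 0.
    apply: contrapT => /forallNP na; have /eqP := a1; rewrite big1 => [|i _].
      by rewrite eq_sym oner_eq0.
    by apply/eqP; apply/negPn/negP; exact: na.
  have [v xiv] := support_neq0 (x i).
  by exists v; apply/convex_bary_neq0 => //; exists i.
- move=> v w /convex_bary_neq0[] // i ai xiv /convex_bary_neq0[] // j aj xjw.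
  exact: cmp xiv xjw.
Qed.

Fact convex_sum : \sum_(v \in [set: P]) convex_bary a x v = 1.
Proof.
have [_ a1 _] := ax.
have /finite_fsetP[A AE] : finite_set (\bigcup_(i in [set: I]) support (x i)).
  apply: bigcup_finite => [|i _]; first exact: finite_finset.
  exact/finite_support_bary/order_complex_finite.
rewrite (fsbigTE A) => [|v vA].
  rewrite /convex_bary exchange_big /= -[RHS]a1; apply: eq_bigr => i _.
  rewrite -mulr_sumr bary_sum_fset ?mulr1 //.
  by rewrite -AE => v xiv; exists i.
apply/eqP; apply: contraNT vA => /convex_bary_neq0[] // i _ xiv.
by have : (\bigcup_(i in [set: I]) support (x i)) v; [exists i|rewrite AE].
Qed.
End ConvexValid.

(* the junk value x0 is taken when the combination is not a point of X *)
Definition convex (x0 : X) (I : finType) (a : I -> R) (x : I -> X) : X :=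
  match pselect (convex_valid a x) with
  | left ax => Realization (fun v => convex_bary_ge0 x v (let: And3 h _ _ := ax in h))
                 (convex_supp ax) (convex_sum ax)
  | right _ => x0
  end.

Lemma bary_convex x0 (I : finType) (a : I -> R) (x : I -> X) :
  convex_valid a x -> bary (convex x0 a x) = convex_bary a x.
Proof. by rewrite /convex; case: pselect. Qed.

Lemma support_convex x0 (I : finType) (a : I -> R) (x : I -> X) v :
  convex_valid a x ->
  support (convex x0 a x) v <-> exists2 i, a i != 0 & support (x i) v.
Proof.
move=> ax; rewrite /support /= bary_convex //.
by apply: convex_bary_neq0; case: ax.
Qed.

Lemma convex_const x0 (I : finType) (a : I -> R) (x : I -> X) y :
  convex_valid a x -> (forall i, a i != 0 -> x i = y) -> convex x0 a x = y.
Proof.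
move=> ax xy; apply: bary_inj => v; rewrite bary_convex // /convex_bary.
have [_ a1 _] := ax.
rewrite (eq_bigr (fun i => a i * bary y v)) => [|i _].
  by rewrite -mulr_suml a1 mul1r.
by have [->|/xy ->//] := eqVneq (a i) 0; rewrite !mul0r.
Qed.

(** By compactness the supports of all the points involved lie in one finite set of vertices, where
    continuity can be checked on coordinates. *)
Lemma convex_continuous x0 (Y : topologicalType) (A : set Y) (I : finType)
    (a : I -> Y -> R) (x : I -> Y -> X) : compact A ->
  (forall i, {within A, continuous (a i)}) ->
  (forall i, {within A, continuous (x i)}) ->
  (forall y, A y -> convex_valid (a^~ y) (x^~ y)) ->
  {within A, continuous (fun y => convex x0 (a^~ y) (x^~ y))}.
Proof.
move=> cA ca cx ax.
apply: (@realization_continuous_within _ _ _ order_complex_finite _ _ _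
  (\bigcup_(i in [set: I]) \bigcup_(z in x i @` A) support z)).
- apply: bigcup_finite => [|i _]; first exact: finite_finset.
  apply: compact_support; first exact: order_complex_finite.
  exact: continuous_compact.
- move=> y Ay v /support_convex[|i _ iv]; first exact: ax.
  by exists i => //; exists (x i y).
move=> v; apply: (@subspace_eq_continuous _ _ _
    (fun y => \sum_i a i y * bary (x i y) v)).
  move=> y /set_mem Ay.
  rewrite -[RHS]/(bary (convex x0 (a^~ y) (x^~ y)) v) bary_convex //; exact: ax.
apply/subspace_continuousP => y Ay.
apply: (@cvg_big R I +%R 0 xpredT _ Y (within A (nbhs y))
  (index_enum I) (fun i y => a i y * bary (x i y) v)) => [z|i _].
  exact: add_continuous.
apply: cvgM; first by move/subspace_continuousP : (ca i); exact.
apply: (@cvg_comp _ _ _ (x i) (fun z => bary z v) _ (nbhs (x i y))).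
  by move/subspace_continuousP : (cx i); exact.
exact: bary_continuous.
Qed.
End ConvexCombinations.

(** * Contracting spheroids *)

Section Clamp.
Variable R : realType.
Implicit Types r y : R.
Local Open Scope ring_scope.

Definition clamp r : R := Num.max 0 (Num.min 1 r).

Lemma clamp_ge0 r : 0 <= clamp r.
Proof. by rewrite /clamp le_max lexx. Qed.

Lemma clamp_le1 r : clamp r <= 1.
Proof. by rewrite /clamp ge_max ler01 ge_min lexx. Qed.

Lemma clamp_eq0 r : r <= 0 -> clamp r = 0.
Proof. by move=> r0; apply/max_idPl; rewrite ge_min r0 orbT. Qed.

Lemma clamp_eq1 r : 1 <= r -> clamp r = 1.
Proof. by move=> r1; rewrite /clamp (min_idPl r1); apply/max_idPr. Qed.

Lemma clamp_id r : 0 <= r <= 1 -> clamp r = r.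
Proof.
by move=> /andP[r0 r1]; rewrite /clamp (min_idPr r1); apply/max_idPr.
Qed.

Lemma clamp_le r y : r <= y -> clamp r <= clamp y.
Proof.
move=> ry; rewrite /clamp ge_max le_max lexx /= le_max.
by apply/orP; right; rewrite le_min !ge_min lexx ry orbT.
Qed.

Lemma clamp_continuous : continuous clamp.
Proof.
move=> r; apply: (@continuous_max R R (cst 0) (fun r => Num.min 1 r)).
  exact: cst_continuous.
by apply: (@continuous_min R R (cst 1) id) => //; exact: cst_continuous.
Qed.

(** The tent function with peak 1 at [a] that vanishes at distance at least 1 from [a]. As a
    difference of two ramps it has telescoping sums, which makes the tents a partition of unity. *)
Definition hat (a : nat) y : R := clamp (y - a%:R + 1) - clamp (y - a%:R).

Lemma hat_ge0 a y : 0 <= hat a y.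
Proof. by rewrite subr_ge0 clamp_le // lerDl ler01. Qed.

Lemma hat_neq0 a y : hat a y != 0 -> `|y - a%:R| < 1.
Proof.
rewrite /hat; have [h|h] := ltP `|y - a%:R| 1 => //.
move: h; rewrite ler_normr => /orP[h|h].
  by rewrite !clamp_eq1 ?subrr ?eqxx //; lra.
by rewrite !clamp_eq0 ?subrr ?eqxx //; lra.
Qed.

Lemma hat_gt0 a y : `|y - a%:R| < 1 -> hat a y != 0.
Proof.
rewrite /hat ltr_norml => /andP[h1 h2]; rewrite subr_eq0.
have [h|h] := leP 0 (y - a%:R).
  by rewrite clamp_eq1 ?clamp_id ?gt_eqF //; lra.
by rewrite (@clamp_eq0 (_ - _)) ?clamp_id ?gt_eqF //; lra.
Qed.

Lemma hat_sum m y : 0 <= y <= m%:R -> \sum_(a < m.+1) hat a y = 1.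
Proof.
move=> /andP[y0 ym]; rewrite -(big_mkord xpredT (fun a => hat a y)).
pose f a : R := - clamp (y - a%:R + 1).
rewrite (eq_bigr (fun a => f a.+1 - f a)) => [|a _]; last first.
  by rewrite /hat /f opprK addrC -natr1 opprD addrA subrK.
rewrite telescope_sumr // /f opprK clamp_eq0; last by rewrite -natr1; lra.
by rewrite clamp_eq1 ?oppr0 ?add0r //; lra.
Qed.

Lemma hat_continuous a : continuous (hat a).
Proof.
move=> y; apply: cvgB.
  apply: (@cvg_comp _ _ _ (fun y => y - a%:R + 1) clamp _ (nbhs (y - a%:R + 1))).
    by apply: cvgD; [apply: cvgB; [exact: cvg_id|exact: cvg_cst]|exact: cvg_cst].
  exact: clamp_continuous.
apply: (@cvg_comp _ _ _ (fun y => y - a%:R) clamp _ (nbhs (y - a%:R))).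
  by apply: cvgB; [exact: cvg_id|exact: cvg_cst].
exact: clamp_continuous.
Qed.

Lemma hat0 a : hat a 0 = (a == 0)%:R.
Proof.
rewrite /hat sub0r; case: a => [|a].
  by rewrite oppr0 add0r clamp_eq1 // clamp_eq0 // subr0.
by rewrite !clamp_eq0 ?subrr // -natr1; have := ler0n R a; lra.
Qed.

Lemma hat_last m a : (a <= m)%N -> hat a m%:R = (a == m)%:R.
Proof.
rewrite /hat leq_eqVlt => /orP[/eqP ->|am].
  by rewrite eqxx subrr add0r clamp_eq1 // clamp_eq0 // subr0.
rewrite (ltn_eqF am) -natrB; last exact: ltnW.
have : 1 <= (m - a)%:R :> R by rewrite ler1n subn_gt0.
by move=> h; rewrite !clamp_eq1 ?subrr //; lra.
Qed.

Lemma hat_close a b y : hat a y != 0 -> hat b y != 0 -> (a <= b.+1)%N.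
Proof.
move=> /hat_neq0 + /hat_neq0; rewrite !ltr_norml => /andP[? ?] /andP[? ?].
have : a%:R < b%:R + 2 :> R by lra.
by rewrite -natrD ltr_nat addn2 ltnS.
Qed.
End Clamp.

Section CubeTopology.
Variable R : realType.
Local Open Scope ring_scope.

Lemma compact_cube n : compact (@cube R n).
Proof.
exact: (@rV_compact R n (fun=> `[0, 1]%classic) (fun=> @segment_compact R 0 1)).
Qed.

Lemma compact_cubeX n : compact (@cube R n `*` `[(0 : R), 1]%classic).
Proof. by apply: compact_setX; [exact: compact_cube|exact: segment_compact]. Qed.

Lemma row_continuous (Y : topologicalType) n (f : 'I_n -> Y -> R) :
  (forall i, continuous (f i)) -> continuous (fun y => \row_i f i y : 'rV[R]_n).
Proof.
move=> cf y A [B nB BA].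
apply: (@filterS _ _ _ [set z | forall i, B ord0 i (f i z)]).
  by move=> z hz; apply: BA => i j; rewrite mxE ord1; exact: hz.
apply: filter_forall => i.
by apply: cf; have := nB ord0 i; rewrite mxE.
Qed.

Lemma within_comp (Y Z W : topologicalType) (A : set Y) (B : set Z)
    (f : Y -> Z) (g : Z -> W) :
  {within A, continuous f} -> (forall y, A y -> B (f y)) ->
  {within B, continuous g} -> {within A, continuous (g \o f)}.
Proof.
move=> /subspace_continuousP cf AB /subspace_continuousP cg.
apply/subspace_continuousP => y Ay U gU.
have := cg _ (AB _ Ay) U gU; rewrite /= => h.
have := cf _ Ay _ h; rewrite /= => h'.
rewrite /nbhs /= in h' *; rewrite /within /= in h' *.
by apply: filterS h' => z hz Az; apply: hz => //; exact: AB.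
Qed.

End CubeTopology.

Section Lebesgue.
Variable (R : realType) (T : pseudoMetricType R) (V : Type).
Local Open Scope ring_scope.

(** Around each point, half the radius of its neighbourhood works by the triangle inequality;
    compactness makes one [e] serve everywhere. *)
Lemma Lebesgue_number (A : set T) (U : V -> set T) : compact A ->
  (forall x, A x -> exists v, within A (nbhs x) (U v)) ->
  exists2 e, 0 < e & forall x, A x -> exists v, forall y, A y -> ball x e y -> U v y.
Proof.
move=> cA AU.
have : \forall e \near (0 : R)^'+,
    A `<=` [set x | exists v, forall y, A y -> ball x e y -> U v y].
  apply: ((near_covering_withinP A).2 ((compact_near_coveringP A).1 cA) _ _
    (fun e x => exists v, forall y, A y -> ball x e y -> U v y)) => x Ax.
  have [v] := AU x Ax; rewrite /within /= => /nbhs_ballP[r /= r0 rU].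
  exists (ball x (r / 2), [set e | e < r / 2]) => /=.
    split; first by apply: nbhsx_ballx; rewrite divr_gt0.
    by apply: nbhs_right_lt; rewrite divr_gt0.
  move=> [z e] [/= xz er] Az; exists v => y Ay zy; apply: rU => //.
  rewrite [r]splitr; apply: ball_triangle xz _.
  exact: le_ball (ltW er) _ zy.
move=> h; near (0 : R)^'+ => e; exists e; last by near: e.
by near: e; exact: nbhs_right_gt.
Unshelve. all: by end_near. Qed.
End Lebesgue.

(** * Free contractions made based through a collar of the cube *)

Section CollarHomotopy.
Variables (R : realType) (X : topologicalType) (n : nat).
Local Open Scope ring_scope.
Local Notation I01 := (`[(0 : R), 1])%classic.

(** Expansion about the centre by the factor 1 + u, clamped back into the cube. At u = 1 the inner
    cube between 1/4 and 3/4 fills the whole cube and its complement goes to the boundary. *)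
Definition cube_stretch (u : R) (t : 'rV[R]_n) : 'rV[R]_n :=
  \row_i clamp ((1 + u) * (t ord0 i - 2^-1) + 2^-1).

(** On the cube this is 0 on the boundary and 1 on the inner cube between 1/4 and 3/4. *)
Definition collar_height (t : 'rV[R]_n) : R :=
  \prod_i (clamp (4 * t ord0 i) * clamp (4 * (1 - t ord0 i))).

Lemma cube_stretch_cube u t : cube (cube_stretch u t).
Proof. by move=> i; rewrite mxE clamp_ge0 clamp_le1. Qed.

Lemma cube_stretch0 t : cube t -> cube_stretch 0 t = t.
Proof.
move=> ht; apply/rowP => i; rewrite mxE addr0 mul1r subrK clamp_id //.
Qed.

Lemma cube_stretch_boundary u t : 0 <= u -> cube_boundary t ->
  cube_boundary (cube_stretch u t).
Proof.
move=> u0 [ct [i ti]]; split; first exact: cube_stretch_cube.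
exists i; rewrite mxE; case: ti => ->; [left|right].
  by rewrite clamp_eq0 //; nra.
by rewrite clamp_eq1 //; nra.
Qed.

Lemma collar_height_ge0 t : 0 <= collar_height t.
Proof. by apply: prodr_ge0 => i _; rewrite mulr_ge0 ?clamp_ge0. Qed.

Lemma collar_height_le1 t : collar_height t <= 1.
Proof.
apply: prodr_ile1 => i _; rewrite mulr_ge0 ?clamp_ge0 //=.
by rewrite mulr_ile1 ?clamp_ge0 ?clamp_le1.
Qed.

Lemma collar_height_boundary t : cube_boundary t -> collar_height t = 0.
Proof.
move=> [_ [i ti]]; rewrite /collar_height (bigD1 i) //=.
by case: ti => ->; rewrite ?subrr mulr0 (@clamp_eq0 _ 0) // !(mul0r, mulr0).
Qed.

Lemma collar_height_inner t : ~ cube_boundary (cube_stretch 1 t) ->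
  collar_height t = 1.
Proof.
move=> nb; rewrite /collar_height big1 // => i _.
have [h|h] := leP (t ord0 i) (4^-1).
  exfalso; apply: nb; split; first exact: cube_stretch_cube.
  by exists i; left; rewrite mxE clamp_eq0 //; lra.
have [h'|h'] := leP (3 / 4) (t ord0 i).
  exfalso; apply: nb; split; first exact: cube_stretch_cube.
  by exists i; right; rewrite mxE clamp_eq1 //; lra.
by rewrite !clamp_eq1 ?mulr1 //; lra.
Qed.

Lemma collar_map_continuous (k c : R) : continuous (fun p : 'rV[R]_n * R =>
  (cube_stretch (k * p.2 + c) p.1, (k * p.2 + c) * collar_height p.1)).
Proof.
have c2 : continuous (fun p : 'rV[R]_n * R => k * p.2 + c).
  move=> p; apply: cvgD; last exact: cvg_cst.
  by apply: cvgM; [exact: cvg_cst|exact: cvg_snd].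
have c1 i : continuous (fun p : 'rV[R]_n * R => p.1 ord0 i).
  move=> p; apply: (@cvg_comp _ _ _ fst (fun t : 'rV[R]_n => t ord0 i) _ (nbhs p.1)).
    exact: cvg_fst.
  exact: coord_continuous.
have c3 : continuous (fun p : 'rV[R]_n * R => cube_stretch (k * p.2 + c) p.1).
  apply: row_continuous => i p.
  apply: (@cvg_comp _ _ _ _ (@clamp R) _
    (nbhs ((1 + (k * p.2 + c)) * (p.1 ord0 i - 2^-1) + 2^-1))).
    apply: cvgD; last exact: cvg_cst.
    apply: cvgM; first by apply: cvgD; [exact: cvg_cst|exact: c2].
    by apply: cvgB; [exact: c1|exact: cvg_cst].
  exact: clamp_continuous.
move=> p; apply: (@cvg_pair _ _ _ (nbhs p)
  (nbhs (cube_stretch (k * p.2 + c) p.1)) (nbhs ((k * p.2 + c) * collar_height p.1))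
  _ _ _ (fun p => cube_stretch (k * p.2 + c) p.1)
  (fun p => (k * p.2 + c) * collar_height p.1)); first exact: c3.
apply: cvgM; first exact: c2.
apply: (@cvg_big R _ *%R 1 xpredT _ ('rV[R]_n * R)%type (nbhs p) _
  (fun i p => clamp (4 * p.1 ord0 i) * clamp (4 * (1 - p.1 ord0 i)))) => [z|i _].
  exact: mul_continuous.
apply: cvgM.
  apply: (@cvg_comp _ _ _ _ (@clamp R) _ (nbhs (4 * p.1 ord0 i))); last exact: clamp_continuous.
  by apply: cvgM; [exact: cvg_cst|exact: c1].
apply: (@cvg_comp _ _ _ _ (@clamp R) _ (nbhs (4 * (1 - p.1 ord0 i)))); last exact: clamp_continuous.
apply: cvgM; [exact: cvg_cst|apply: cvgB; [exact: cvg_cst|exact: c1]].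
Qed.

Lemma homotopy_group_trivialP (x0 : X) :
  (forall f g : 'rV[R]_n -> X, spheroid x0 f -> spheroid x0 g ->
    spheroid_homotopic x0 f g) ->
  homotopy_group_trivial R n x0.
Proof.
move=> fg.
have clE f : spheroid x0 f -> spheroid_class x0 f = @spheroid R X n x0.
  by move=> sf; apply/seteqP; split=> [g []//|g sg]; split => //; exact: fg.
have s0 : @spheroid R X n x0 (cst x0) by split => //; exact: cst_continuous.
rewrite /homotopy_group_trivial /homotopy_group.
by apply/seteqP; split=> [_ [f sf <-]|_ ->]; [rewrite /= !clE|exists (cst x0)].
Qed.

(* A contraction that drags the base point along gamma is made based by
   running through gamma in a collar of the boundary of the cube. *)
Lemma homotopy_group_trivial_contract (x0 q : X) (gamma : R -> X) :
  (forall f : 'rV[R]_n -> X, spheroid x0 f -> exists h : 'rV[R]_n * R -> X,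
    [/\ {within @cube R n `*` I01, continuous h},
        forall t, cube t -> h (t, 0) = f t,
        forall t, cube t -> h (t, 1) = q &
        forall t (s : R), cube_boundary t -> 0 <= s <= 1 -> h (t, s) = gamma s]) ->
  homotopy_group_trivial R n x0.
Proof.
move=> contr; apply: homotopy_group_trivialP => f g sf sg.
have [hf [cf f0 f1 fb]] := contr f sf; have [hg [cg g0 g1 gb]] := contr g sg.
have gamma0 (t : 'rV[R]_n) : cube_boundary t -> gamma 0 = x0.
  move=> bt; rewrite -(fb t) ?lexx ?ler01 // f0; last by case: bt.
  by case: sf => _; exact.
pose col u (t : 'rV[R]_n) := (cube_stretch u t, u * collar_height t).
have colP u t : 0 <= u <= 1 -> (@cube R n `*` I01) (col u t).
  move=> /andP[u0 u1]; split => /=; first exact: cube_stretch_cube.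
  by rewrite in_itv /= mulr_ge0 ?collar_height_ge0 //= mulr_ile1 ?collar_height_ge0 ?collar_height_le1.
(* The first half runs the contraction of [f], the second half runs that of [g] backwards. *)
pose H (p : 'rV[R]_n * R) := if p.2 <= 2^-1 then hf (col (2 * p.2) p.1)
  else hg (col (2 - 2 * p.2) p.1).
(* In the collar both sides equal [gamma] at the collar height, and on the inner cube both equal
   [q]. *)
have mid t : hf (col 1 t) = hg (col 1 t).
  have [b|nb] := pselect (cube_boundary (cube_stretch 1 t)).
    by rewrite /col mul1r fb ?gb // collar_height_ge0 collar_height_le1.
  by rewrite /col mul1r collar_height_inner // f1 ?g1 //; exact: cube_stretch_cube.
exists H; split.
- have -> : @cube R n `*` I01 = (@cube R n `*` `[0, 2^-1]) `|` (@cube R n `*` `[2^-1, 1]).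
    apply/seteqP; split=> [[t s] [/= ct]|[t s] [] [/= ct]]; rewrite /= !in_itv /=.
    + by move=> h; have [h'|h'] := leP s 2^-1; [left|right]; split => //=; lra.
    + by move=> h; split => //=; lra.
    + by move=> h; split => //=; lra.
  have clX (a b : R) : closed (@cube R n `*` `[a, b]%classic).
    apply: compact_closed; first exact: norm_hausdorff.
    by apply: compact_setX; [exact: compact_cube|exact: segment_compact].
  apply: withinU_continuous => //.
    have w : {within @cube R n `*` `[0, 2^-1]%classic,
        continuous (hf \o (fun p => col (2 * p.2 + 0) p.1))}.
      apply: within_comp cf; first exact/continuous_subspaceT/collar_map_continuous.
      by move=> [t s] [/= ct]; rewrite in_itv /= => ?; apply: colP; lra.
    apply: subspace_eq_continuous w.
    move=> [t s] /set_mem [/= ct]; rewrite in_itv /= => /andP[s0 s1].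
    by rewrite /from_subspace /= /H /= s1 addr0.
  have w : {within @cube R n `*` `[2^-1, 1]%classic,
      continuous (hg \o (fun p => col (- 2 * p.2 + 2) p.1))}.
    apply: within_comp cg; first exact/continuous_subspaceT/collar_map_continuous.
    by move=> [t s] [/= ct]; rewrite in_itv /= => ?; apply: colP; lra.
  apply: subspace_eq_continuous w.
  move=> [t s] /set_mem [/= ct]; rewrite in_itv /= => /andP[s0 s1].
  rewrite /from_subspace /= /H /= (_ : - 2 * s + 2 = 2 - 2 * s); last by lra.
  case: leP => // s2; have -> : s = 2^-1 by apply/eqP; rewrite eq_le s0 s2.
  rewrite divff ?pnatr_eq0 // mid; congr (hg (col _ t)); lra.
- move=> t ct; rewrite /H /= invr_ge0 ler0n mulr0 /col mul0r cube_stretch0 //.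
  exact: f0.
- move=> t ct; rewrite /H /= ifF; last by apply/negbTE; rewrite -ltNge; lra.
  by rewrite mulr1 subrr /col mul0r cube_stretch0 //; exact: g0.
- move=> t s bt /andP[s0 s1]; rewrite /H /= /col collar_height_boundary // !mulr0.
  rewrite -(gamma0 t bt); case: leP => h.
    by apply: fb; [apply: cube_stretch_boundary => //; lra|rewrite lexx ler01].
  by apply: gb; [apply: cube_stretch_boundary => //; lra|rewrite lexx ler01].
Qed.
End CollarHomotopy.

(** * Contractions in layers *)

Section LayeredContraction.
Context (R : realType) {d : Order.disp_t} (P : porderType d) (n : nat).
Local Notation X := (realization R (@order_complex d P)).
Local Open Scope ring_scope.

(** Layer [j] is the combination of the vertices [layer_label i j] with the partition of unity
    [layer_weight]; the spheroid itself is layer 0. Comparable labels in consecutive layers keep the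
    segments between them in the complex. Over the boundary all active labels agree with [b], the
    track of the base point. *)
Record layered_contraction (J : nat) (q : P) (b : nat -> P)
    (f : 'rV[R]_n -> X) : Prop := LayeredContraction {
  layer_index : finType;
  layer_weight : layer_index -> 'rV[R]_n -> R;
  layer_label : layer_index -> nat -> P;
  layer_continuous : forall i, continuous (layer_weight i);
  layer_ge0 : forall i t, cube t -> 0 <= layer_weight i t;
  layer_sum : forall t, cube t -> \sum_i layer_weight i t = 1;
  layer_first : forall i t v, cube t -> layer_weight i t != 0 ->
    support (f t) v -> comparable_verts v (layer_label i 1%N);
  layer_comparable : forall i i' j j' t, cube t ->
    layer_weight i t != 0 -> layer_weight i' t != 0 ->
    (0 < j)%N -> (j <= j')%N -> (j' <= j.+1)%N -> (j' <= J)%N ->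
    comparable_verts (layer_label i j) (layer_label i' j');
  layer_last : forall i, layer_label i J = q;
  layer_boundary : forall i j t, cube_boundary t -> layer_weight i t != 0 ->
    layer_label i j = b j }.

(* The homotopy is linear on the successive layers
   f, layer 1, ..., layer J, with layer J constant at the vertex q. *)
Lemma homotopy_group_trivial_layers (x0 : X) (J : nat) (q : P) (b : nat -> P) :
  (0 < J)%N ->
  (forall f : 'rV[R]_n -> X, spheroid x0 f -> layered_contraction J q b f) ->
  homotopy_group_trivial R n x0.
Proof.
move=> J0 layers.
pose pt (x : X) (w : nat -> P) (j : nat) : X := if j == 0%N then x else vertex R (w j).
pose gamma (s : R) := convex x0 (fun j : 'I_J.+1 => hat j (J%:R * s))
  (fun j : 'I_J.+1 => pt x0 b j).
apply: (@homotopy_group_trivial_contract R X n x0 (vertex R q) gamma) => f sf.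
have [I lam w lamc lam0 lam1 wf wc wq wb] := layers f sf.
(* The time tent selects at most two consecutive layers, and [lam] weights the labels within a
   layer. *)
pose a (k : 'I_J.+1 * I) (p : 'rV[R]_n * R) : R := hat k.1 (J%:R * p.2) * lam k.2 p.1.
pose x (k : 'I_J.+1 * I) (p : 'rV[R]_n * R) : X := pt (f p.1) (w k.2) k.1.
have s01 (s : R) : 0 <= s <= 1 -> 0 <= J%:R * s <= J%:R.
  by move=> /andP[s0 s1]; rewrite mulr_ge0 //= ler_piMr.
have av p : (@cube R n `*` `[0, 1]%classic) p -> convex_valid (a^~ p) (x^~ p).
  case: p => t s [/= ct]; rewrite in_itv /= => hs; split.
  - by move=> k; rewrite mulr_ge0 ?hat_ge0 ?lam0.
  - rewrite /a /= -(pair_bigA _ (fun (j : 'I_J.+1) i => hat j (J%:R * s) * lam i t)) /=.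
    under eq_bigr do rewrite -mulr_sumr lam1 // mulr1.
    by rewrite hat_sum // s01.
  - move=> [j i] [j' i'] v v'; rewrite /a /x /=.
    rewrite !mulf_eq0 !negb_or => /andP[hj li] /andP[hj' li'].
    wlog jj' : j j' i i' v v' hj hj' li li' / (j <= j')%N.
      move=> wl sv sv'; have /orP[|] := leq_total j j'.
        by move=> jj'; exact: (wl j j' i i').
      by move=> jj'; apply: comparable_verts_sym; exact: (wl j' j i' i).
    have j'j := hat_close hj' hj; rewrite /pt.
    case: (posnP j) => [j0|j0].
      rewrite j0 in j'j *; case: (posnP j') => [j'0|j'0].
        exact: support_comparable.
      have j'1 : j' = 1%N :> nat by apply/eqP; rewrite eqn_leq j'j j'0.
      by move=> sv /support_vertex ->; rewrite j'1; exact: (wf _ t).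
    rewrite gtn_eqF ?(leq_trans j0 jj') //.
    move=> /support_vertex -> /support_vertex ->; apply: (wc _ _ _ _ t) => //.
    by rewrite -ltnS ltn_ord.
exists (fun p => convex x0 (a^~ p) (x^~ p)); split.
- apply: convex_continuous => //; first exact: compact_cubeX.
    move=> k; apply: continuous_subspaceT => p; apply: cvgM.
      apply: (@cvg_comp _ _ _ (fun p => J%:R * p.2) (@hat R k.1) _ (nbhs (J%:R * p.2))).
        by apply: cvgM; [exact: cvg_cst|exact: cvg_snd].
      exact: hat_continuous.
    apply: (@cvg_comp _ _ _ fst (lam k.2) _ (nbhs p.1)); first exact: cvg_fst.
    exact: lamc.
  move=> [j i]; rewrite /x /pt /=; case: eqP => _; last first.
    by apply: continuous_subspaceT => p; exact: cvg_cst.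
  have cf : {within @cube R n, continuous f} by case: sf.
  apply: within_comp cf; last by move=> p [].
  by apply: continuous_subspaceT => p; exact: cvg_fst.
- move=> t ct; apply: convex_const.
    by apply: av; split => //=; rewrite in_itv /= lexx ler01.
  move=> [j i]; rewrite /a /x /= mulr0 hat0 mulf_eq0 negb_or => /andP[+ _].
  by rewrite /pt; case: (eqVneq (j : nat) 0%N) => // _; rewrite /= mulr0n eqxx.
- move=> t ct; apply: convex_const.
    by apply: av; split => //=; rewrite in_itv /= lexx ler01.
  move=> [j i]; rewrite /a /x /= mulr1 hat_last; last by rewrite -ltnS ltn_ord.
  rewrite mulf_eq0 negb_or => /andP[+ _].
  case: (eqVneq (j : nat) J) => [->|_ /=]; last by rewrite mulr0n eqxx.
  by rewrite /pt gtn_eqF // wq.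
(* On the boundary the points of a layer coincide, so summing over the indices of the partition of
   unity leaves [gamma s]. *)
- move=> t s bt hs; have ct : cube t by case: bt.
  have ft : f t = x0 by case: sf => _; exact.
  have vt := av (t, s); rewrite /= in vt.
  have {}vt : convex_valid (a^~ (t, s)) (x^~ (t, s)) by apply: vt; split.
  have [i0 li0] : exists i, lam i t != 0.
    apply: contrapT => /forallNP na; have /eqP := lam1 t ct; rewrite big1 => [|i _].
      by rewrite eq_sym oner_eq0.
    by apply/eqP; apply/negPn/negP; exact: na.
  have ptE i j : lam i t != 0 -> pt (f t) (w i) j = pt x0 b j.
    by move=> li; rewrite /pt ft; case: eqP => // _; rewrite (wb _ _ t).
  have vg : convex_valid (fun j : 'I_J.+1 => hat j (J%:R * s))
      (fun j : 'I_J.+1 => pt x0 b j).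
    have [_ _ cmp] := vt; split.
    + by move=> j; exact: hat_ge0.
    + by rewrite hat_sum // s01.
    + move=> j j' v v' hj hj'; rewrite -!(ptE i0) //.
      by apply: (cmp (j, i0) (j', i0)); rewrite /a /= mulf_neq0.
  apply: bary_inj => v; rewrite /gamma !bary_convex // /convex_bary /a /x /=.
  rewrite -(pair_bigA _ (fun (j : 'I_J.+1) i =>
    hat j (J%:R * s) * lam i t * bary (pt (f t) (w i) j) v)) /=.
  apply: eq_bigr => j _.
  rewrite (eq_bigr (fun i => lam i t * (hat j (J%:R * s) * bary (pt x0 b j) v))).
    by rewrite -mulr_suml lam1 // mul1r.
  move=> i _; have [->|li] := eqVneq (lam i t) 0; first by rewrite mulr0 !mul0r.
  by rewrite ptE // mulrAC mulrC.
Qed.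
End LayeredContraction.

(** * The coset poset *)

Section CosetPoset.
Variable G : groupType.
Implicit Types (x y z t g : G) (D : set G).
Local Open Scope group_scope.
Local Notation F := (@nilpotent_subgroups G 2).
Local Notation P := (coset_poset F).
Local Notation T := (@triple_commutator G).

Lemma coset_vertexP (v : P) : left_cosets F (val v).
Proof. exact: set_mem (valP v). Qed.

Lemma coset_poset_leP (v w : P) : reflect (val v `<=` val w) (v <= w)%O.
Proof.
rewrite -[(v <= w)%O]/(val v <= val w)%O.
by apply: (iffP idP); rewrite subsetEset.
Qed.

Lemma comparable_sub (v w : P) : val v `<=` val w -> comparable_verts v w.
Proof. by move=> vw; left; apply/coset_poset_leP. Qed.

Lemma comparable_sup (v w : P) : val w `<=` val v -> comparable_verts v w.
Proof. by move=> vw; right; apply/coset_poset_leP. Qed.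

Lemma left_coset_neq0 D : left_cosets F D -> exists x, D x.
Proof. by move=> [g [H [[[H1 _ _] _] ->]]]; exists (g * 1), 1. Qed.

(** The smallest left coset of any subgroup that contains the three points. *)
Definition hull x y z : set G :=
  left_coset x (generated [set x^-1 * y; x^-1 * z]).

Lemma hull_mem1 x y z : hull x y z x.
Proof.
exists 1; last by rewrite mulg1.
by have [] := subgroup_generated [set x^-1 * y; x^-1 * z].
Qed.

Lemma hull_mem2 x y z : hull x y z y.
Proof.
by exists (x^-1 * y); [apply: sub_generated; left|rewrite mulVKg].
Qed.

Lemma hull_mem3 x y z : hull x y z z.
Proof.
by exists (x^-1 * z); [apply: sub_generated; right|rewrite mulVKg].
Qed.

Lemma hull_sub D x y z : left_cosets F D -> D x -> D y -> D z -> hull x y z `<=` D.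
Proof.
move=> FD Dx Dy Dz _ [h Hh <-].
have [H [sH _] [Hy DE]] := left_coset_mulV FD Dx Dy.
rewrite DE; exists h => //; apply: (generated_sub sH) Hh => _ [] -> //.
by move: Dz; rewrite DE => -[k Hk <-]; rewrite mulKg.
Qed.

Lemma left_cosets_unit : left_cosets F (left_coset 1 [set 1]).
Proof.
exists 1, [set 1]; split => //; split.
  by split=> // [x y -> ->|x ->]; rewrite ?mulg1 ?invg1.
by apply/nilpotent_class_le2P => x y z -> -> ->; rewrite !comm1g.
Qed.

(* the junk value is the coset {1}, used when the hull is not of class 2 *)
Definition hull_vertex x y z : P :=
  match pselect (left_cosets F (hull x y z)) with
  | left FD => SigSub (mem_set FD)
  | right _ => SigSub (mem_set left_cosets_unit)
  end.

Hypothesis nil3 : forall x y z t, [~ x, y, z, t] = 1.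

Lemma subgroup_triple_eq0l y z : subgroup [set x | T x y z = 0%R].
Proof.
split=> [|x x' /= e e'|x /= e]; rewrite /= ?triple1l //.
  by rewrite tripleDl // e e' addr0.
by rewrite tripleNl // e oppr0.
Qed.

Lemma subgroup_triple_eq0m x z : subgroup [set y | T x y z = 0%R].
Proof.
split=> [|y y' /= e e'|y /= e]; rewrite /= ?triple1m //.
  by rewrite tripleDm // e e' addr0.
by rewrite tripleNm // e oppr0.
Qed.

Lemma subgroup_triple_eq0r x y : subgroup [set z | T x y z = 0%R].
Proof.
split=> [|z z' /= e e'|z /= e]; rewrite /= ?triple1r //.
  by rewrite tripleDr // e e' addr0.
by rewrite tripleNr // e oppr0.
Qed.

(** T vanishes on triples of generators, and its zero set in each slot is a subgroup; so the
    vanishing is extended one slot at a time. *)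
Lemma generated2_class2 x y : T x y x = 0%R -> T x y y = 0%R ->
  F (generated [set x; y]).
Proof.
move=> xyx xyy; split; first exact: subgroup_generated.
have yxx : T y x x = 0%R by rewrite tripleC // xyx oppr0.
have yxy : T y x y = 0%R by rewrite tripleC // xyy oppr0.
have S3 a b c : [set x; y] a -> [set x; y] b -> [set x; y] c -> T a b c = 0%R.
  by move=> [] -> [] -> [] ->; rewrite ?triplexx.
have S2 a b c : generated [set x; y] a -> [set x; y] b -> [set x; y] c -> T a b c = 0%R.
  move=> Sa Sb Sc; apply: (generated_sub (subgroup_triple_eq0l b c)) Sa => u Su.
  exact: S3.
have S1 a b c : generated [set x; y] a -> generated [set x; y] b ->
    [set x; y] c -> T a b c = 0%R.
  move=> Sa Sb Sc; apply: (generated_sub (subgroup_triple_eq0m a c)) Sb => u Su.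
  exact: S2.
apply/nilpotent_class_le2P => a b c Sa Sb Sc; apply/eqP; rewrite -triple_eq0 //.
apply/eqP; apply: (generated_sub (subgroup_triple_eq0r a b)) Sc => u Su.
exact: S1.
Qed.

(** The hull of two points is a coset of a cyclic group. *)
Lemma left_cosets_hull2 x y : left_cosets F (hull x y y).
Proof.
by exists x, (generated [set x^-1 * y; x^-1 * y]); split => //;
  apply: generated2_class2; rewrite triplexx.
Qed.

Lemma val_hull_vertex2 x y : val (hull_vertex x y y) = hull x y y.
Proof.
by rewrite /hull_vertex; case: pselect => // -[]; exact: left_cosets_hull2.
Qed.

Section Engel.
Hypothesis engelG : two_engel G.

Lemma left_cosets_hull3 x y z : left_cosets F (hull x y z).
Proof.
exists x, (generated [set x^-1 * y; x^-1 * z]); split => //.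
by apply: generated2_class2; [exact: triplexyx|exact: triplexyy].
Qed.

Lemma val_hull_vertex3 x y z : val (hull_vertex x y z) = hull x y z.
Proof.
by rewrite /hull_vertex; case: pselect => // -[]; exact: left_cosets_hull3.
Qed.
End Engel.

(** The first element of [l] lying in the coset, or an arbitrary element of the coset if there is
    none; [l] thus prescribes representatives by priority. *)
Definition coset_rep (l : seq G) (v : P) : G :=
  nth (xget 1 (val v)) l (find (fun g => `[< val v g >]) l).

Lemma coset_rep_mem l v : val v (coset_rep l v).
Proof.
rewrite /coset_rep; have [h|h] := boolP (has (fun g => `[< val v g >]) l).
  by have /asboolP := nth_find (xget 1 (val v)) h.
rewrite (hasNfind h) nth_default //.
have [x vx] := left_coset_neq0 (coset_vertexP v).
exact: (xgetPex 1 (ex_intro _ x vx)).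
Qed.

Lemma chain_seq_max (s : seq P) : s != [::] ->
  {in s &, forall v w, comparable_verts v w} ->
  exists2 m, m \in s & forall v, v \in s -> (v <= m)%O.
Proof.
elim: s => // v s IH _ cmp; have [->|s0] := eqVneq s [::].
  by exists v; rewrite ?mem_head // => w; rewrite inE => /eqP ->.
have [|m ms mmax] := IH s0.
  by move=> u w us ws; apply: cmp; rewrite inE ?us ?ws orbT.
have [vm|mv] := cmp v m (mem_head _ _) (mem_behead (s := v :: s) ms).
  by exists m => [|w]; rewrite inE ?ms ?orbT // => /orP[/eqP ->|/mmax].
exists v => [|w]; rewrite ?mem_head // inE => /orP[/eqP -> //|/mmax wm].
exact: le_trans wm mv.
Qed.

Section Realization.
Variable R : realType.
Local Notation X := (realization R (@order_complex _ P)).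

(** The cosets supporting a point form a finite chain, whose largest member serves as [D]. This is
    what brings representatives of the vertices into one coset. *)
Lemma support_coset (x : X) :
  exists2 D, left_cosets F D & forall v, support x v -> val v `<=` D.
Proof.
have /finite_fsetP[S SE] := finite_support_bary (@order_complex_finite _ P) x.
have [m mS mmax] : exists2 m, m \in S & forall v, v \in S -> (v <= m)%O.
  apply: chain_seq_max.
    have [v] := support_neq0 x; rewrite SE /= => vS; apply/eqP => S0.
    by have : v \in enum_fset S by []; rewrite S0.
  move=> v w vS wS; apply: (@support_comparable R _ _ x); by rewrite SE.
exists (val m); first exact: coset_vertexP.
by move=> v; rewrite SE => /mmax/coset_poset_leP.
Qed.

Lemma class2_homotopy_trivial n (x0 : X) : nilpotent_class_le 2 [set: G] ->
  homotopy_group_trivial R n x0.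
Proof.
move=> nG; have FT : left_cosets F [set: G].
  exists 1, [set: G]; split; first by split.
  by apply/seteqP; split=> // x _; exists x; rewrite ?mul1g.
pose top : P := SigSub (mem_set FT).
have topP v : comparable_verts v top by apply: comparable_sub => ? _.
(* A single layer at the top coset contracts the cone. *)
apply: (@homotopy_group_trivial_layers R _ P n x0 1 top (fun=> top)) => // f _.
exists unit (fun _ _ => 1%R) (fun _ _ => top) => //.
- by move=> _; exact: cst_continuous.
- by move=> t _; rewrite big_const card_unit /= addr0.
Qed.
End Realization.
End CosetPoset.

(** * Two-Engel groups *)

Local Open Scope ring_scope.

Lemma grid_point_dist (R : realType) (m i : nat) (r e : R) :
  (m.+1%:R^-1 < e)%R -> (`|i%:R - m.+1%:R * r| <= 1)%R ->
  (`|i%:R / m.+1%:R - r| < e)%R.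
Proof.
move=> me ir; apply: le_lt_trans me.
have m0 : m.+1%:R != 0 :> R by rewrite pnatr_eq0.
rewrite (_ : i%:R / m.+1%:R - r = (i%:R - m.+1%:R * r) / m.+1%:R)%R; last first.
  by rewrite mulrBl [X in _ = (_ - X)%R]mulrAC divff // mul1r.
by rewrite normrM normfV normr_nat ler_piMl // invr_ge0.
Qed.

Section EngelConnected.
Variables (R : realType) (G : groupType).
Local Notation F := (@nilpotent_subgroups G 2).
Local Notation P := (coset_poset F).
Local Notation X := (realization R (@order_complex _ P)).
Hypothesis nil3 : forall x y z t : G, [~ x, y, z, t]%g = 1%g.
Hypothesis engelG : two_engel G.
Local Notation hv := (@hull_vertex G).
Local Notation one := (1%g : G).

Lemma hv_le x y z x' y' z' : hull x' y' z' x -> hull x' y' z' y -> hull x' y' z' z ->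
  val (hv x y z) `<=` val (hv x' y' z').
Proof.
move=> hx hy hz; rewrite !val_hull_vertex3 //.
by apply: hull_sub => //; exact: left_cosets_hull3.
Qed.

Lemma hv_le_vertex x y z (v : P) : val v x -> val v y -> val v z ->
  val (hv x y z) `<=` val v.
Proof.
by move=> ? ? ?; rewrite val_hull_vertex3 //; apply: hull_sub => //; exact: coset_vertexP.
Qed.

(* Layers 1..7 above a vertex v of the loop with representative g, and above
   an edge of the loop with upper end m and representatives g, g' (the entry of
   index 0 is a dummy). *)
Definition vertex_layer (v : P) (g : G) (j : nat) : P :=
  nth (hv one one one) [:: v; v; hv g g g; hv g g g; hv g g g; hv one g g] j.

Definition edge_layer (m : P) (g g' : G) (j : nat) : P :=
  nth (hv one one one)
    [:: m; m; m; hv g g' g'; hv one g g'; hv one g g'; hv one g g'] j.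

Local Ltac hull_incl := rewrite /=; first
  [ done
  | solve [apply: hv_le; first [exact: hull_mem1 | exact: hull_mem2 | exact: hull_mem3]]
  | solve [apply: hv_le_vertex; done] ].

Local Ltac layer_cmp := rewrite /vertex_layer /edge_layer /= ?nth_nil; first
  [ exact: comparable_verts_refl
  | apply: comparable_sub; solve [hull_incl]
  | apply: comparable_sup; solve [hull_incl] ].

Lemma vertex_layer_comparable v g j j' : val v g ->
  (j <= j')%N -> (j' <= j.+1)%N ->
  comparable_verts (vertex_layer v g j) (vertex_layer v g j').
Proof.
move=> vg jj' j'j; have [->|->] : j' = j \/ j' = j.+1 by lia.
  exact: comparable_verts_refl.
clear jj' j'j; do 7 (case: j => [|j]; first by layer_cmp).
by layer_cmp.
Qed.

Lemma edge_layer_comparable m g g' j j' : val m g -> val m g' ->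
  (j <= j')%N -> (j' <= j.+1)%N ->
  comparable_verts (edge_layer m g g' j) (edge_layer m g g' j').
Proof.
move=> mg mg' jj' j'j; have [->|->] : j' = j \/ j' = j.+1 by lia.
  exact: comparable_verts_refl.
clear jj' j'j; do 7 (case: j => [|j]; first by layer_cmp).
by layer_cmp.
Qed.

(** The repetitions in the two tables are staggered: at each step at most one of the tracks moves,
    and the vertex label stays inside the edge label even across a step. *)
Lemma vertex_edge_layer_comparable v m g g1 g2 j j' : val v g -> val v `<=` val m ->
  val m g1 -> val m g2 -> g = g1 \/ g = g2 ->
  (j <= j')%N -> (j' <= j.+1)%N ->
  comparable_verts (vertex_layer v g j) (edge_layer m g1 g2 j') /\
  comparable_verts (edge_layer m g1 g2 j) (vertex_layer v g j').
Proof.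
move=> vg vm mg1 mg2 gg jj' j'j.
have mg : val m g by exact: vm.
have [->|->] : j' = j \/ j' = j.+1 by lia.
  clear jj' j'j; case: gg => ?; subst g;
    do 7 (case: j => [|j]; first by split; layer_cmp); split; layer_cmp.
clear jj' j'j; case: gg => ?; subst g;
    do 7 (case: j => [|j]; first by split; layer_cmp); split; layer_cmp.
Qed.

Lemma engel_pi0 (x0 : X) : homotopy_group_trivial R 0 x0.
Proof.
apply: (@homotopy_group_trivial_layers R _ P 0 x0 7 (hv one one one)
  (fun=> hv one one one)) => // f _.
have [v fv] := support_neq0 (f 0).
pose g := coset_rep [::] v.
exists unit (fun _ _ => 1) (fun _ j => vertex_layer v g j) => //.
- by move=> _; exact: cst_continuous.
- by move=> t _; rewrite big_const card_unit /= addr0.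
- move=> _ t u _ _; have -> : t = 0 by apply/rowP => -[].
  by move=> fu; exact: support_comparable fu fv.
- move=> _ _ j j' t _ _ _ _ jj' j'j _; apply: vertex_layer_comparable => //.
  exact: coset_rep_mem.
- by move=> _ j t [_ [[]]].
Qed.

(** The cover consists of the stars of the vertices pulled back by [f], with both ends of the
    interval removed from all of them but that of [w0]; a ball reaching an end is then labelled
    [w0]. *)
Lemma loop_cover (x0 : X) (w0 : P) (f : 'rV[R]_1 -> X) :
  support x0 w0 -> spheroid x0 f ->
  exists2 e : R, 0 < e & forall t, cube t -> exists v, forall s, cube s ->
    ball t e s -> support (f s) v /\ (v = w0 \/ ~ cube_boundary s).
Proof.
move=> x0w0 [cf fb].
apply: (@Lebesgue_number R 'rV[R]_1 P (@cube R 1)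
  (fun v s => support (f s) v /\ (v = w0 \/ ~ cube_boundary s))).
  exact: compact_cube.
move=> t ct; have near_star v : support (f t) v ->
    within (@cube R 1) (nbhs t) (fun s => support (f s) v).
  move=> ftv; have /subspace_continuousP/(_ t ct [set x | bary x v != 0]) := cf; apply.
  by apply: open_nbhs_nbhs; split => //; exact: open_star.
have [bt|nbt] := pselect (cube_boundary t).
  exists w0; have := near_star w0; rewrite fb // => /(_ x0w0).
  by apply: filterS => s; split => //; left.
have [v ftv] := support_neq0 (f t); exists v.
have t0 : t ord0 ord0 != 0 by apply/eqP => h; apply: nbt; split => //; exists ord0; left.
have t1 : t ord0 ord0 != 1 by apply/eqP => h; apply: nbt; split => //; exists ord0; right.
have nt (c : R) : t ord0 ord0 != c ->
    within (@cube R 1) (nbhs t) (fun s : 'rV[R]_1 => s ord0 ord0 != c).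
  move=> tc; have : nbhs t (fun s : 'rV[R]_1 => s ord0 ord0 != c).
    apply: (@coord_continuous R 1 1 ord0 ord0 t [set r | r != c]).
    by apply: open_nbhs_nbhs; split => //; exact: open_neq.
  by rewrite /within /=; apply: filterS.
have h0 := nt _ t0; have h1 := nt _ t1; have hv' := near_star v ftv.
near=> s; split; first by near: s.
right=> -[_ [i]]; rewrite (ord1 i) => -[] /eqP; apply/negP; near: s => //.
Unshelve. all: by end_near. Qed.

Lemma engel_pi1 (x0 : X) : homotopy_group_trivial R 1 x0.
Proof.
have [w0 x0w0] := support_neq0 x0.
pose rep := @coset_rep G [::].
have repP v : val v (rep v) by exact: coset_rep_mem.
apply: (@homotopy_group_trivial_layers R _ P 1 x0 7 (hv one one one)
  (vertex_layer w0 (rep w0))) => // f sf.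
have [e e0 he] := loop_cover x0w0 sf.
have [m] := ltr_add_invr e0; rewrite add0r => me.
set N := m.+1; pose pt i : 'rV[R]_1 := const_mx (i%:R / N%:R).
have N0 : (0 < N%:R :> R) by rewrite ltr0n.
have ptc i : (i <= N)%N -> cube (pt i).
  move=> iN j; rewrite mxE divr_ge0 //= ler_pdivrMr // mul1r ler_nat //.
have /choice[v vP] : forall i, exists v, (i <= N)%N -> forall s, cube s ->
    ball (pt i) e s -> support (f s) v /\ (v = w0 \/ ~ cube_boundary s).
  move=> i; have [iN|iN] := leqP i N; last by exists w0.
  by have [v hv'] := he _ (ptc i iN); exists v.
have vw0 i : (i <= N)%N -> cube_boundary (pt i) -> v i = w0.
  move=> iN bi; have [|_ []//] := vP i iN (pt i) (ptc i iN).
  exact: ballxx.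
have v0 : v 0%N = w0.
  by apply: vw0 => //; split; [exact: ptc|exists ord0; left; rewrite mxE mul0r].
have vN : v N = w0.
  apply: vw0 => //; split; [exact: ptc|exists ord0; right].
  by rewrite mxE divff // gt_eqF.
have vstar i s : (i <= N)%N -> cube s -> `|i%:R - N%:R * s ord0 ord0| <= 1 ->
    support (f s) (v i).
  move=> iN cs h; suff: ball (pt i) e s by move=> /(vP i iN s cs)[].
  split => // j k; rewrite !ord1 mxE.
  exact: grid_point_dist.
pose mx i : P := if (v i <= v i.+1)%O then v i.+1 else v i.
(* As in a barycentric subdivision, even [k] stands for the grid vertex [k./2] and odd [k] for the
   edge that follows it. *)
pose lab (k j : nat) : P := if odd k then edge_layer (mx k./2) (rep (v k./2)) (rep (v k./2.+1)) j
  else vertex_layer (v k./2) (rep (v k./2)) j.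
pose lam (k : 'I_(2 * N).+1) (t : 'rV[R]_1) : R := hat k ((2 * N)%:R * t ord0 ord0).
have lamP (k : 'I_(2 * N).+1) t : cube t -> lam k t != 0 -> support (f t) (v k./2) /\
    (odd k -> (k./2.+1 <= N)%N /\ support (f t) (v k./2.+1)).
  move=> ct /hat_neq0; have := odd_double_half k; set i := k./2.
  have := ltn_ord k; rewrite ltnS => kN ik; rewrite -{1}ik.
  have iN : (i <= N)%N by lia.
  rewrite natrM; set r := t ord0 ord0; set o := odd k.
  rewrite -mul2n natrD natrM ltr_norml => /andP[h1 h2].
  have o01 : 0 <= (o%:R : R) <= 1 by case: (o); rewrite ?lexx ?ler01.
  split; first by apply: vstar => //; rewrite ler_norml; rewrite -/r; lra.
  move=> ok; have iN' : (i.+1 <= N)%N by lia.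
  split => //; apply: vstar => //; rewrite ler_norml -[i.+1%:R]natr1 -/r.
  have o1 : o%:R = 1 :> R by rewrite ok.
  lra.
have mxP i : comparable_verts (v i) (v i.+1) ->
    [/\ val (v i) `<=` val (mx i), val (v i.+1) `<=` val (mx i) & mx i = v i \/ mx i = v i.+1].
  rewrite /mx; case: ifPn => [h _|nh [|h]].
  - by split; [apply/coset_poset_leP|done|right].
  - by rewrite (negbTE nh).
  - by split; [done|apply/coset_poset_leP|left].
have cmpE (k : 'I_(2 * N).+1) t : cube t -> lam k t != 0 -> odd k ->
    comparable_verts (v k./2) (v k./2.+1).
  move=> ct lk ok; have [h1 h2] := lamP k t ct lk; have [_ h3] := h2 ok.
  exact: support_comparable h1 h3.
exists 'I_(2 * N).+1 lam (fun (k : 'I_(2 * N).+1) => lab k) => //.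
- move=> k t; apply: (@cvg_comp _ _ _ (fun t : 'rV[R]_1 => (2 * N)%:R * t ord0 ord0)
    (@hat R k) _ (nbhs ((2 * N)%:R * t ord0 ord0))).
    apply: (@continuousM R 'rV[R]_1 (fun=> (2 * N)%:R) (fun t => t ord0 ord0)).
      exact: cst_continuous.
    exact: coord_continuous.
  exact: hat_continuous.
- by move=> k t _; exact: hat_ge0.
- move=> t ct; apply: hat_sum; have /andP[t0 t1] := ct ord0.
  by rewrite mulr_ge0 //= ler_piMr.
- move=> k t u ct lk fu; have [h1 h2] := lamP k t ct lk.
  rewrite /lab; case: ifPn => [ok|_]; last exact: support_comparable fu h1.
  have [_ h3] := h2 ok; have [_ _ [h|h]] := mxP _ (cmpE k t ct lk ok).
    by rewrite /edge_layer /= h; exact: support_comparable fu h1.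
  by rewrite /edge_layer /= h; exact: support_comparable fu h3.
(* Overlapping tents have indices at distance at most 1, so two active indices coincide or are an
   edge and one of its ends. *)
- move=> k k' j j' t ct lk lk' _ jj' j'j _; rewrite /lab.
  have kk' : (k <= k'.+1)%N by exact: hat_close lk lk'.
  have k'k : (k' <= k.+1)%N by exact: hat_close lk' lk.
  case: ifPn => ok; case: ifPn => ok'.
  + have -> : k' = k :> nat by lia.
    have [m1 m2 _] := mxP _ (cmpE k t ct lk ok).
    by apply: edge_layer_comparable => //; [exact: m1|exact: m2].
  + have [m1 m2 _] := mxP _ (cmpE k t ct lk ok).
    have gg : k'./2 = k./2 \/ k'./2 = k./2.+1 by lia.
    apply: (vertex_edge_layer_comparable _ _ _ _ _ jj' j'j).2 => //.
    * by case: gg => ->.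
    * exact: m1.
    * exact: m2.
    * by case: gg => ->; [left|right].
  + have [m1 m2 _] := mxP _ (cmpE k' t ct lk' ok').
    have gg : k./2 = k'./2 \/ k./2 = k'./2.+1 by lia.
    apply: (vertex_edge_layer_comparable _ _ _ _ _ jj' j'j).1 => //.
    * by case: gg => ->.
    * exact: m1.
    * exact: m2.
    * by case: gg => ->; [left|right].
  + have -> : k' = k :> nat by lia.
    exact: vertex_layer_comparable.
- by move=> k; rewrite /lab; case: ifP.
- move=> k j t [ct [i]]; rewrite (ord1 i) /lam => -[] ->.
    rewrite mulr0 hat0; case: (eqVneq (k : nat) 0%N) => [k0 _|_]; last by rewrite mulr0n eqxx.
    by rewrite /lab k0 /= v0.
  rewrite mulr1 hat_last -1?ltnS ?ltn_ord //.
  case: (eqVneq (k : nat) (2 * N)%N) => [kN _|_]; last by rewrite mulr0n eqxx.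
  by rewrite /lab kN mul2n odd_double doubleK vN.
Qed.

Lemma engel_1connected : k_connected R (coset_complex R F) 1.
Proof.
split; first by exists (vertex R (hv one one one)).
by move=> [|[|//]] x0 _; [exact: engel_pi0|exact: engel_pi1].
Qed.
End EngelConnected.

(** * Discretized null homotopies *)

(** Cell [i] is assigned to the nearest coarse node: the shift by [k] is half a coarse interval, so
    the cell stays within half an interval of that node. *)
Lemma cell_hat (R : realType) (M k i : nat) (r : R) : (0 < k)%N ->
  i%:R <= (2 * k * M)%:R * r <= i.+1%:R ->
  hat ((i + k) %/ (2 * k)) (M%:R * r) != 0.
Proof.
move=> k0 ir; apply: hat_gt0; set u := (_ %/ _)%N.
have [h1 h2] : ((2 * k * u <= i + k) /\ (i.+1 <= 2 * k * u + k))%N.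
  have k2 : (0 < 2 * k)%N by rewrite muln_gt0.
  have := divn_eq (i + k) (2 * k); have := ltn_pmod (i + k) k2.
  rewrite -/u; move: ((i + k) %% (2 * k))%N => p; rewrite (mulnC u); lia.
move: h1 h2; rewrite -!(ler_nat R) !natrD !natrM => h1 h2.
have k0' : (0 < k%:R :> R) by rewrite ltr0n.
rewrite !natrM in ir; rewrite -(ltr_pM2l k0') mulr1 -{1}(gtr0_norm k0') -normrM ltr_norml.
by rewrite mulrBr mulrA; lra.
Qed.

Lemma cell_index_steps (k : nat) i : (0 < k)%N ->
  ((i.+1 + k) %/ (2 * k) = (i + k) %/ (2 * k) \/
   (i.+1 + k) %/ (2 * k) = ((i + k) %/ (2 * k)).+1)%N.
Proof.
move=> k0; have k2 : (0 < 2 * k)%N by rewrite muln_gt0.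
have h1 : ((i + k) %/ (2 * k) <= (i.+1 + k) %/ (2 * k))%N by apply: leq_div2r; lia.
have h2 : ((i.+1 + k) %/ (2 * k) <= (i + k + 2 * k) %/ (2 * k))%N by apply: leq_div2r; lia.
have h3 : ((i + k + 2 * k) %/ (2 * k) = ((i + k) %/ (2 * k)).+1)%N.
  by rewrite divnDr ?dvdnn // divnn k2 addn1.
by rewrite h3 in h2; lia.
Qed.

Section GridSpheroid.
Context (R : realType) {d : Order.disp_t} (P : porderType d) (n : nat).
Local Notation X := (realization R (@order_complex d P)).

Lemma spheroid_nullhomotopic (x0 : X) : homotopy_group_trivial R n x0 ->
  forall f : 'rV[R]_n -> X, spheroid x0 f -> spheroid_homotopic x0 f (cst x0).
Proof.
move=> tr f sf.
have s0 : @spheroid R X n x0 (cst x0) by split => //; exact: cst_continuous.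
have : @homotopy_group R X n x0 (spheroid_class x0 f) by exists f.
rewrite tr => fE.
have : spheroid_class x0 (cst x0) (cst x0 : 'rV[R]_n -> X).
  split => //; exists (cst x0); split => //.
  exact: cst_continuous.
by rewrite -fE => -[].
Qed.

Variables (M : nat) (W : ('I_n -> nat) -> P) (w0 : P).
Hypothesis M0 : (0 < M)%N.
Hypothesis Wcmp : forall c c', (forall i, c i <= M)%N -> (forall i, c' i <= M)%N ->
  (forall i, c i <= (c' i).+1)%N -> (forall i, c' i <= (c i).+1)%N ->
  comparable_verts (W c) (W c').
Hypothesis Wboundary : forall c, (forall i, c i <= M)%N ->
  (exists i, c i = 0 \/ c i = M)%N -> W c = w0.

(** Products of tents form a partition of unity on the cube, and grid points whose products overlap
    are neighbours with comparable labels; so [W] can be interpolated inside the complex. *)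
Lemma grid_spheroid : exists2 f : 'rV[R]_n -> X, spheroid (vertex R w0) f &
  forall t c, cube t -> (forall i, c i <= M)%N ->
    (forall i, hat (c i) (M%:R * t ord0 i) != 0) -> support (f t) (W c).
Proof.
pose I := {ffun 'I_n -> 'I_M.+1}.
pose a (c : I) (t : 'rV[R]_n) : R := \prod_i hat (c i) (M%:R * t ord0 i).
pose x (c : I) (t : 'rV[R]_n) : X := vertex R (W (fun i => c i)).
have cM (c : I) i : (c i <= M)%N by rewrite -ltnS ltn_ord.
have aP c t : a c t != 0 -> forall i, hat (c i) (M%:R * t ord0 i) != 0.
  by move=> ac i; have /prodf_neq0/(_ i) := ac; apply.
have av t : cube t -> convex_valid (a^~ t) (x^~ t).
  move=> ct; split.
  - by move=> c; apply: prodr_ge0 => i _; exact: hat_ge0.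
  - rewrite /a -(bigA_distr_bigA (fun i (j : 'I_M.+1) => hat j (M%:R * t ord0 i))) /=.
    rewrite big1 // => i _; apply: hat_sum; have /andP[t0 t1] := ct i.
    by rewrite mulr_ge0 //= ler_piMr.
  - move=> c c' v v' /aP ac /aP ac' /support_vertex -> /support_vertex ->.
    by apply: Wcmp => // i; [exact: hat_close (ac i) (ac' i)|exact: hat_close (ac' i) (ac i)].
exists (fun t => convex (vertex R w0) (a^~ t) (x^~ t)); first split.
- apply: convex_continuous => //; first exact: compact_cube.
    move=> c; apply: continuous_subspaceT => t.
    apply: (@cvg_big R _ *%R 1 xpredT _ 'rV[R]_n (nbhs t) _
      (fun i t => hat (c i) (M%:R * t ord0 i))) => [z|i _].
      exact: mul_continuous.
    apply: (@cvg_comp _ _ _ (fun t : 'rV[R]_n => M%:R * t ord0 i)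
      (@hat R (c i)) _ (nbhs (M%:R * t ord0 i))).
      apply: (@continuousM R 'rV[R]_n (fun=> M%:R) (fun t => t ord0 i)).
        exact: cst_continuous.
      exact: coord_continuous.
    exact: hat_continuous.
  by move=> c; exact: cst_continuous.
- move=> t [ct [i ti]]; apply: convex_const; first exact: av.
  move=> c /aP ac; congr (vertex R _); apply: Wboundary => //; exists i.
  have := ac i; case: ti => ->; rewrite ?mulr0 ?mulr1 ?hat0 ?hat_last //.
    by case: (eqVneq (c i : nat) 0%N) => [|_ /=]; [left|rewrite mulr0n eqxx].
  by case: (eqVneq (c i : nat) M) => [|_ /=]; [right|rewrite mulr0n eqxx].
- move=> t c ct cM' hc; apply/support_convex; first exact: av.
  have cE i : (inord (c i) : 'I_M.+1) = c i :> nat by rewrite inordK // ltnS.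
  exists [ffun i => inord (c i)].
    by apply/prodf_neq0 => i _; rewrite ffunE cE.
  rewrite /x (_ : (fun i => _) = c); first exact: support_vertex_refl.
  by apply/funext => i; rewrite ffunE cE.
Qed.

(* phi c k is a vertex whose open star contains the image of the cell with
   index (c, k - 1) of the null homotopy; the layer k = 0 is read off from W. *)
Lemma grid_nullhomotopy : homotopy_group_trivial R n (vertex R w0) ->
  exists (m : nat) (u : nat -> nat) (phi : ('I_n -> nat) -> nat -> P),
  [/\ [/\ u 0%N = 0%N, u m = M &
         forall i, u i.+1 = u i \/ u i.+1 = (u i).+1],
      forall c, (forall i, c i <= m)%N -> phi c 0%N = W (u \o c),
      forall c k, (forall i, c i <= m)%N -> (k <= m.+1)%N ->
        (exists i, c i = 0 \/ c i = m)%N \/ k = m.+1 -> phi c k = w0 &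
      forall c k, (forall i, c i < m)%N -> (k <= m)%N ->
        exists x : X, forall e k', (forall i, e i <= 1)%N -> (k' <= 1)%N ->
          support x (phi (fun i => e i + c i)%N (k' + k)%N)].
Proof.
move=> tr; have [f sf fW] := grid_spheroid.
have [h [ch h0 h1 hb]] := spheroid_nullhomotopic tr sf.
pose A := @cube R n `*` `[(0 : R), 1]%classic.
have [e e0 he] : exists2 e : R, 0 < e & forall p, A p -> exists v,
    forall q, A q -> ball p e q -> support (h q) v.
  apply: (@Lebesgue_number R ('rV[R]_n * R)%type P A (fun v q => support (h q) v)).
    exact: compact_cubeX.
  move=> p Ap; have [v hpv] := support_neq0 (h p); exists v.
  have /subspace_continuousP/(_ p Ap [set x | bary x v != 0]) := ch; apply.
  by apply: open_nbhs_nbhs; split => //; exact: open_star.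
have [k0] := ltr_add_invr e0; rewrite add0r => ke.
(* Each of the [M] coarse intervals is cut into [2 * k] cells, shorter than the Lebesgue number.
   Cells are numbered from 0, so [m] is the last one. *)
pose k := k0.+1; pose N := (2 * k * M)%N; pose m := N.-1.
have NE : N = m.+1 by rewrite /m prednK // /N !muln_gt0.
have m1 : (1 <= m)%N by rewrite /m /N /k; nia.
have Ne : m.+1%:R^-1 < e.
  apply: le_lt_trans ke; rewrite lef_pV2 ?posrE ?ltr0n // ler_nat -NE /N /k; nia.
have N0 : 0 < (m.+1%:R : R) by rewrite ltr0n.
pose pt (c : 'I_n -> nat) (j : nat) : 'rV[R]_n * R :=
  (\row_i ((c i)%:R / m.+1%:R), j%:R / m.+1%:R).
have ge01 j : (j <= m.+1)%N -> 0 <= (j%:R / m.+1%:R : R) <= 1.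
  by move=> jm; rewrite divr_ge0 //= ler_pdivrMr // mul1r ler_nat.
have Apt c j : (forall i, c i <= m.+1)%N -> (j <= m.+1)%N -> A (pt c j).
  by move=> cm jm; split => [i|]; rewrite /= ?mxE ?in_itv /=; exact: ge01.
have /choice[V0 V0P] : forall cj : ('I_n -> nat) * nat, exists v,
    (forall i, cj.1 i <= m.+1)%N -> (cj.2 <= m.+1)%N ->
    forall q, A q -> ball (pt cj.1 cj.2) e q -> support (h q) v.
  move=> [c j] /=; have [[cm jm]|nc] := pselect ((forall i, c i <= m.+1)%N /\ (j <= m.+1)%N).
    by have [v hv] := he _ (Apt c j cm jm); exists v.
  by exists w0 => cm jm; exfalso; apply: nc.
have VP c j t s : (forall i, c i <= m)%N -> (j <= m)%N -> cube t -> 0 <= s <= 1 ->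
    (forall i, (c i)%:R <= m.+1%:R * t ord0 i <= (c i).+1%:R) ->
    j%:R <= m.+1%:R * s <= j.+1%:R -> support (h (t, s)) (V0 (c, j)).
  move=> cm jm ct s01 ctc js; apply: V0P => /=; try exact: leqW.
  - by move=> i; exact: leqW.
  - by split => //=; rewrite in_itv.
  - split; rewrite /=.
      split => // i0 i; rewrite (ord1 i0) mxE; apply: grid_point_dist => //.
      by have := ctc i; rewrite ler_norml -natr1; lra.
    apply: grid_point_dist => //.
    by move: js; rewrite ler_norml -natr1; lra.
pose u i := ((i + k) %/ (2 * k))%N.
have u0 : u 0%N = 0%N by rewrite /u divn_small // /k; lia.
have um : u m = M.
  rewrite /u (_ : m + k = M * (2 * k) + k.-1)%N; last by move: NE; rewrite /N /k; lia.
  by rewrite divnMDl ?muln_gt0 // divn_small ?addn0 // /k; lia.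
have uM i : (i <= m)%N -> (u i <= M)%N.
  by move=> im; rewrite -um; apply: leq_div2r; rewrite leq_add2r.
pose phi c j := if j is j'.+1 then V0 (c, j') else W (u \o c).
have phi0P c t : (forall i, c i <= m)%N -> cube t ->
    (forall i, (c i)%:R <= m.+1%:R * t ord0 i <= (c i).+1%:R) ->
    support (h (t, 0)) (phi c 0%N).
  move=> cm ct ctc; rewrite h0 //; apply: fW => // i; first exact: uM.
  by apply: cell_hat => //; rewrite -/N NE.
have cellx j : j%:R <= m.+1%:R * (j%:R / m.+1%:R : R) <= j.+1%:R.
  by rewrite mulrC mulfVK ?gt_eqF // lexx ler_nat /=.
have cellS j : j%:R <= m.+1%:R * (j.+1%:R / m.+1%:R : R) <= j.+1%:R.
  by rewrite mulrC mulfVK ?gt_eqF // lexx ler_nat leqnSn.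
exists m, u, phi; split => //.
- by split => // i; exact: cell_index_steps.
- move=> c j cm jm bd.
  (* The star of the label contains the image of the cell, so a single point of the cell sent to the
     vertex [w0] forces the label to be [w0]. *)
  suff [t [s [h2 h3]]] : exists t s, h (t, s) = vertex R w0 /\
      support (h (t, s)) (phi c j).
    by move: h3; rewrite h2 => /support_vertex.
  have [[i ci]|jE] := pselect (exists i, c i = 0 \/ c i = m)%N; last first.
    case: bd => // jE'; subst j; exists (\row_i ((c i)%:R / m.+1%:R)), 1.
    have ct : cube (\row_i ((c i)%:R / m.+1%:R) : 'rV[R]_n).
      by move=> i; rewrite mxE; apply: ge01; exact: leqW.
    split; first by rewrite h1.
    apply: VP => //; first by rewrite lexx ler01.
      by move=> i; rewrite mxE.
    by rewrite mulr1 lexx ler_nat leqnSn.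
  (* A point of the cell on the boundary of the cube: first cells reach 0 and last cells reach 1. *)
  pose t : 'rV[R]_n := \row_j (if c j == 0%N then 0 else if c j == m then 1
    else (c j)%:R / m.+1%:R).
  have ct : cube t.
    move=> l; rewrite mxE; case: ifP => _; first by rewrite lexx ler01.
    by case: ifP => _; [rewrite ler01 lexx|apply: ge01; exact: leqW].
  have bt : cube_boundary t.
    split => //; exists i; rewrite mxE; case: ci => ->; first by left; rewrite eqxx.
    by right; rewrite gtn_eqF // eqxx.
  have tc l : (c l)%:R <= m.+1%:R * t ord0 l <= (c l).+1%:R.
    rewrite mxE; case: eqP => [->|_]; first by rewrite mulr0 lexx ler01.
    by case: eqP => [->|_]; [rewrite mulr1 lexx ler_nat leqnSn|exact: cellx].
  case: j jm bd => [|j] jm _.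
    by exists t, 0; split; [apply: hb => //; rewrite lexx ler01|exact: phi0P].
  exists t, (j%:R / m.+1%:R); split; first by apply: hb => //; exact: ge01 (ltnW jm).
  by apply: VP => //; exact: ge01 (ltnW jm).
- move=> c j cm jm.
  (* This upper corner of cell [c] is shared by all the neighbouring cells considered, and time j /
     (m + 1) by the layers [j] and [j.+1] of [phi]. *)
  pose t : 'rV[R]_n := \row_i ((c i).+1%:R / m.+1%:R).
  have ct : cube t by move=> i; rewrite mxE; apply: ge01; exact: ltnW (cm i).
  exists (h (t, j%:R / m.+1%:R)) => ep k' ep1 k'1.
  have cm' i : (ep i + c i <= m)%N.
    by have := ep1 i; have := cm i; lia.
  have tc i : (ep i + c i)%:R <= m.+1%:R * t ord0 i <= (ep i + c i).+1%:R.
    rewrite mxE; have := ep1 i; case: (ep i) => [|[|//]] _; rewrite ?add0n ?add1n //.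
  have j01 := ge01 j (leqW jm).
  case: k' k'1 => [|[|//]] _; rewrite ?add0n ?add1n; last first.
    by apply: VP => //.
  case: j jm j01 => [|j] jm j01; first by rewrite mul0r; exact: phi0P.
  by apply: VP => //; exact: ltnW.
Qed.
End GridSpheroid.

(** * The obstructions *)

Section Obstructions.
Variables (R : realType) (G : groupType).
Local Notation F := (@nilpotent_subgroups G 2).
Local Notation P := (coset_poset F).
Local Notation X := (realization R (@order_complex _ P)).
Local Notation T := (@triple_commutator G).
Local Notation hv := (@hull_vertex G).
Local Notation one := (1%g : G).
Hypothesis nil3 : forall x y z t : G, [~ x, y, z, t]%g = 1%g.

Lemma hull_diag (x y : G) : hull x x x y -> y = x.
Proof.
move=> [h + <-]; rewrite mulVg => hh.
suff -> : h = 1%g by rewrite mulg1.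
have : [set one] h; last by [].
apply: generated_sub hh; last by move=> ? [].
by split=> // [? ? -> ->|? ->]; rewrite ?mulg1 ?invg1.
Qed.

Lemma hull_vertex2_le (x y p q : G) : hull p q q x -> hull p q q y ->
  val (hv x y y) `<=` val (hv p q q).
Proof.
move=> hx hy; rewrite !val_hull_vertex2 //.
by apply: hull_sub => //; exact: left_cosets_hull2.
Qed.

Lemma coset_rep_diag l x : coset_rep l (hv x x x) = x.
Proof.
by apply: hull_diag; rewrite -val_hull_vertex2 //; exact: coset_rep_mem.
Qed.

(** * The fundamental group and the 2-Engel identity *)

Section EngelObstruction.
Hypothesis exp3 : forall x y z : G, ([~ x, y, z] ^+ 3 = 1)%g.
Local Notation c1 := (@engel_cochain G).

Lemma pi1_trivial_engel :
  (forall x0 : X, homotopy_group_trivial R 1 x0) -> two_engel G.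
Proof.
move=> pi1; apply: engel_cochain_eq0 => // a b.
(* The triangle 1, a, b with each edge subdivided at the hull of its ends; index 6 reads the
   default, which closes the loop. *)
pose L i := nth (hv one one one) [:: hv one one one; hv one a a; hv a a a;
  hv a b b; hv b b b; hv one b b] i.
have LS i : comparable_verts (L i) (L i.+1).
  rewrite /L; do 6 (case: i => [|i]; first by rewrite /=; first
    [ solve [apply: comparable_sub; apply: hull_vertex2_le;
        first [exact: hull_mem1|exact: hull_mem2]]
    | solve [apply: comparable_sup; apply: hull_vertex2_le;
        first [exact: hull_mem1|exact: hull_mem2]] ]).
  by rewrite /= !nth_nil; exact: comparable_verts_refl.
pose W (c : 'I_1 -> nat) : P := L (c ord0).
have Wcmp c c' : (forall i, c i <= 6)%N -> (forall i, c' i <= 6)%N ->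
    (forall i, c i <= (c' i).+1)%N -> (forall i, c' i <= (c i).+1)%N ->
    comparable_verts (W c) (W c').
  move=> _ _ /(_ ord0) h /(_ ord0) h'; rewrite /W.
  have [->|[->|->]] : c ord0 = c' ord0 \/
      (c ord0 = (c' ord0).+1 \/ c' ord0 = (c ord0).+1) by lia.
  - exact: comparable_verts_refl.
  - exact/comparable_verts_sym/LS.
  - exact: LS.
have Wb c : (forall i, c i <= 6)%N -> (exists i, c i = 0 \/ c i = 6)%N ->
    W c = hv one one one.
  by move=> _ [i]; rewrite (ord1 i) /W => -[] ->.
have [m [u [phi [[u0 um uS] phi0 phib phix]]]] :=
  grid_nullhomotopy (isT : (0 < 6)%N) Wcmp Wb (pi1 _).
pose rep := @coset_rep G [::].
have repb v : v = hv one one one -> rep v = one by move=> ->; exact: coset_rep_diag.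
have sum0 : \sum_(0 <= i < m) c1 (rep (phi (fun=> i) 0%N)) (rep (phi (fun=> i.+1) 0%N)) = 0.
  apply: (@stokes_square _ _ c1 (fun i j => rep (phi (fun=> i) j)) one m m.+1).
  - exact: engel_cochain1l.
  (* The four corner labels support one point, so their representatives share a coset, where [c1] is
     additive along both ways around the cell. *)
  - move=> i j im jm; have [//|x xP] := phix (fun=> i) j (fun=> im).
    have [D FD DP] := support_coset x.
    have DR ei ej : (ei <= 1)%N -> (ej <= 1)%N -> D (rep (phi (fun=> ei + i)%N (ej + j)%N)).
      by move=> ei1 ej1; apply: DP (coset_rep_mem _ _); exact: (xP (fun=> ei)).
    have D00 := DR 0%N 0%N isT isT; have D10 := DR 1%N 0%N isT isT.
    have D01 := DR 0%N 1%N isT isT; have D11 := DR 1%N 1%N isT isT.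
    by rewrite (engel_cochainD nil3 exp3 FD D00 D10 D11)
      (engel_cochainD nil3 exp3 FD D00 D01 D11).
  - by move=> j jm; apply: repb; apply: phib => //; left; exists ord0; left.
  - by move=> j jm; apply: repb; apply: phib => //; left; exists ord0; right.
  - by move=> i im; apply: repb; apply: phib => //; right.
move: sum0.
rewrite (@eq_big_nat _ _ _ _ _ _ (fun i => c1 (rep (L (u i))) (rep (L (u i.+1))))); last first.
  by move=> i /andP[_ im]; rewrite !phi0 // => _; exact: ltnW.
rewrite (@sum_monotone_steps _ (fun i j => c1 (rep (L i)) (rep (L j))) u m) //; last first.
  by move=> i; rewrite /engel_cochain !triplexx // addr0.
(* Six half edges remain. Each pair adds up within its hull, leaving c(1, a) + c(a, b) + c(b, 1), of
   which only the middle term survives. *)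
rewrite um !big_nat_recr //= big_geq // add0r /rep !coset_rep_diag -/rep.
have repE x y : hull x y y (rep (hv x y y)).
  by rewrite -val_hull_vertex2 //; exact: coset_rep_mem.
have FE x y := left_cosets_hull2 nil3 x y.
have edge x y : c1 x (rep (hv x y y)) + c1 (rep (hv x y y)) y = c1 x y.
  by apply: (engel_cochainD nil3 exp3 (FE x y)) => //; [exact: hull_mem1|exact: hull_mem2].
have e1 : c1 one (rep (hv one a a)) + c1 (rep (hv one a a)) a = 0.
  by rewrite edge engel_cochain1l.
have e3 : c1 b (rep (hv one b b)) + c1 (rep (hv one b b)) one = 0.
  rewrite -(engel_cochain1r nil3 b).
  by apply: (engel_cochainD nil3 exp3 (FE one b)) => //; [exact: hull_mem2|exact: hull_mem1].
by move=> sum0; rewrite -[RHS]sum0 e1 add0r -[RHS]addrA e3 addr0 edge.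
Qed.
End EngelObstruction.

(** * The second homotopy group and the class of G *)

Section SphereObstruction.
Hypothesis engelG : two_engel G.
Variables a b d : G.

(* The boundary of the tetrahedron with vertices 1, a, b, d (numbered 0, 1, 2,
   3), unfolded on a square whose boundary is collapsed to the vertex 1: two
   null homotopies of the triangle (1, a, b), by its own face in the upper part
   and by the cone with apex d in the lower part. *)
Definition sphere_table : seq (seq (nat * nat * nat)) :=
  let o := (0, 0, 0)%N in
  let v i := (i, i, i) in
  let e i j : nat * nat * nat := (i, j, j) in
  [:: nseq 9 o;
      [:: o; o; (0, 1, 2); (0, 1, 2); (0, 1, 2); (0, 1, 2); (0, 1, 2); o; o]%N;
      [:: o; o; e 0 1; v 1; e 1 2; v 2; e 0 2; o; o]%N;
      [:: o; o; (0, 1, 3); v 1; (1, 2, 3); v 2; (0, 2, 3); o; o]%N;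
      [:: o; o; (0, 1, 3); e 1 3; (1, 2, 3); e 2 3; (0, 2, 3); o; o]%N;
      [:: o; o; (0, 1, 3); v 3; (1, 2, 3); v 3; (0, 2, 3); o; o]%N;
      [:: o; o; e 0 3; v 3; v 3; v 3; e 0 3; o; o]%N;
      [:: o; o; e 0 3; e 0 3; e 0 3; e 0 3; e 0 3; o; o]%N;
      nseq 9 o].

Definition sphere_label (i j : nat) : nat * nat * nat :=
  nth (0, 0, 0)%N (nth [::] sphere_table i) j.

Definition triple_subset (s t : nat * nat * nat) : bool :=
  all (mem [:: t.1.1; t.1.2; t.2]) [:: s.1.1; s.1.2; s.2].

Definition tetra (i : nat) : G := nth one [:: one; a; b; d] i.

Definition tetra_face (t : nat * nat * nat) : P :=
  hv (tetra t.1.1) (tetra t.1.2) (tetra t.2).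

Lemma sphere_label_adjacent i j i' j' : (i <= 8)%N -> (j <= 8)%N ->
  (i' <= 8)%N -> (j' <= 8)%N -> (i <= i'.+1)%N -> (i' <= i.+1)%N ->
  (j <= j'.+1)%N -> (j' <= j.+1)%N ->
  triple_subset (sphere_label i j) (sphere_label i' j') ||
  triple_subset (sphere_label i' j') (sphere_label i j).
Proof.
move=> i8 j8 i'8 j'8 ii' i'i jj' j'j.
pose test i j i' j' := [&& (i <= i'.+1)%N, (i' <= i.+1)%N, (j <= j'.+1)%N & (j' <= j.+1)%N] ==>
  (triple_subset (sphere_label i j) (sphere_label i' j') ||
   triple_subset (sphere_label i' j') (sphere_label i j)).
have : all (fun i => all (fun j => all (fun i' => all (test i j i') (iota 0 9))
  (iota 0 9)) (iota 0 9)) (iota 0 9) by vm_compute.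
move=> /allP/(_ i); rewrite mem_iota => /(_ i8).
move=> /allP/(_ j); rewrite mem_iota => /(_ j8).
move=> /allP/(_ i'); rewrite mem_iota => /(_ i'8).
move=> /allP/(_ j'); rewrite mem_iota => /(_ j'8).
by rewrite /test ii' i'i jj' j'j.
Qed.

Lemma tetra_face_le s t : triple_subset s t -> val (tetra_face s) `<=` val (tetra_face t).
Proof.
move=> /allP st.
have mem i : i \in [:: s.1.1; s.1.2; s.2] ->
    hull (tetra t.1.1) (tetra t.1.2) (tetra t.2) (tetra i).
  move=> /st; rewrite !inE => /or3P[] /eqP ->.
  - exact: hull_mem1.
  - exact: hull_mem2.
  - exact: hull_mem3.
by apply: hv_le => //; apply: mem; rewrite !inE eqxx ?orbT.
Qed.

Lemma tetra_face_mem t i : i \in [:: t.1.1; t.1.2; t.2] -> val (tetra_face t) (tetra i).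
Proof.
rewrite val_hull_vertex3 // !inE => /or3P[] /eqP ->.
- exact: hull_mem1.
- exact: hull_mem2.
- exact: hull_mem3.
Qed.

Hypothesis abd : T a b d != 0.

(** If 1 were in the hull of a, b, d, the cone primitive with apex 1 would give T(a, b, d) = 0. *)
Lemma tetra_face_notin1 t : triple_subset t (1, 2, 3)%N -> ~ val (tetra_face t) one.
Proof.
move=> /tetra_face_le h /h; rewrite val_hull_vertex3 // => h1.
apply/negP: abd; rewrite negbK; apply/eqP.
rewrite (triple_coboundary nil3 engelG (left_cosets_hull3 nil3 engelG a b d) h1).
- by rewrite !triple1l // addr0 subr0.
- exact: hull_mem1.
- exact: hull_mem2.
- exact: hull_mem3.
Qed.

(** T(h, b, d) vanishes for h in the group generated by [b^-1 * d], hence T(bh, b, d) vanishes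
    too. *)
Lemma tetra_face_notin_a : ~ val (tetra_face (2, 3, 3)%N) a.
Proof.
rewrite val_hull_vertex3 // => -[h hh ha].
apply/negP: abd; rewrite negbK; apply/eqP.
rewrite -ha tripleDl // triplexx // add0r.
apply: (generated_sub (subgroup_triple_eq0l nil3 b d)) hh => _ [] -> /=;
  by rewrite tripleDl // tripleNl // triplexx // triplexyx // oppr0 addr0.
Qed.

Local Notation rep := (coset_rep [:: one; a; b; d]).

(** Every table entry names its lowest vertex first. As T(a, b, d) is nonzero, earlier vertices of
    the list stay out of the hull, except for singletons, whose representative is forced. *)
Lemma coset_rep_sphere_label i j : (i <= 8)%N -> (j <= 8)%N ->
  rep (tetra_face (sphere_label i j)) = tetra (sphere_label i j).1.1.
Proof.
move=> i8 j8.
pose t := sphere_label i j.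
have : [|| t.1.1 == 0%N, (t.1.1 == 1%N) && triple_subset t (1, 2, 3)%N,
    t == (2, 3, 3)%N | (t.1.1 == t.1.2) && (t.1.1 == t.2)].
  rewrite /t; move: i8 j8; rewrite -(ltnS i) -(ltnS j) => i8 j8.
  have /allP/(_ i) : all (fun i => all (fun j => let t := sphere_label i j in
    [|| t.1.1 == 0%N, (t.1.1 == 1%N) && triple_subset t (1, 2, 3)%N,
    t == (2, 3, 3)%N | (t.1.1 == t.1.2) && (t.1.1 == t.2)]) (iota 0 9)) (iota 0 9).
    by vm_compute.
  by rewrite mem_iota => /(_ i8)/allP/(_ j); rewrite mem_iota => /(_ j8).
rewrite -/t; case/or4P => [/eqP t0|/andP[/eqP t1 st]|/eqP ->|/andP[/eqP e1 /eqP e2]].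
- rewrite t0; have h : val (tetra_face t) one.
    by apply: (@tetra_face_mem t 0); rewrite !inE t0.
  by rewrite /coset_rep /= asboolT.
- rewrite t1; have h : val (tetra_face t) a.
    by apply: (@tetra_face_mem t 1); rewrite !inE t1.
  rewrite /coset_rep /= asboolF /=; last exact: tetra_face_notin1.
  by rewrite asboolT.
- have h : val (tetra_face (2, 3, 3)%N) b by exact: (@tetra_face_mem (2, 3, 3)%N 2).
  rewrite /coset_rep /= asboolF /=; last exact: tetra_face_notin1.
  rewrite asboolF /=; last exact: tetra_face_notin_a.
  by rewrite asboolT.
- by rewrite /tetra_face -e1 -e2 coset_rep_diag.
Qed.

(** T is alternating and vertex 0 is the identity, so only the permutations of 1, 2, 3 count, with
    their signs. *)
Definition tetra_sign (i j k : nat) : int :=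
  if (i, j, k) \in [:: (1, 2, 3); (2, 3, 1); (3, 1, 2)]%N then 1
  else if (i, j, k) \in [:: (2, 1, 3); (1, 3, 2); (3, 2, 1)]%N then -1 else 0.

Lemma triple_tetra i j k : T (tetra i) (tetra j) (tetra k) = T a b d *~ tetra_sign i j k.
Proof.
have far m : tetra m.+4 = one by rewrite /tetra /= nth_nil.
have tr x y z : T x y z = T z x y by exact: triple_rot.
move: i j k; do 3 (case=> [|[|[|[|?]]]]); rewrite ?far /tetra_sign /= /tetra /=
  ?(mulr0z, mulr1z, mulrN1z); first
  [ exact: triple1l | exact: triple1m | exact: triple1r | exact: triplexx
  | exact: triplexyy | exact: triplexyx | done | exact: tripleC
  | exact: tripleCr | exact: triple_rot | by rewrite -triple_rot
  | by rewrite tripleC // triple_rot ].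
Qed.

Lemma pi2_nontrivial : ~ (forall x0 : X, homotopy_group_trivial R 2 x0).
Proof.
move=> pi2.
pose W (c : 'I_2 -> nat) : P := tetra_face (sphere_label (c ord0) (c ord_max)).
have Wcmp c c' : (forall i, c i <= 8)%N -> (forall i, c' i <= 8)%N ->
    (forall i, c i <= (c' i).+1)%N -> (forall i, c' i <= (c i).+1)%N ->
    comparable_verts (W c) (W c').
  move=> cM c'M cc' c'c; rewrite /W.
  have := @sphere_label_adjacent (c ord0) (c ord_max) (c' ord0) (c' ord_max).
  move=> /(_ (cM _) (cM _) (c'M _) (c'M _) (cc' _) (c'c _) (cc' _) (c'c _)) /orP[] /tetra_face_le.
    exact: comparable_sub.
  exact: comparable_sup.
have Wb c : (forall i, c i <= 8)%N -> (exists i, c i = 0 \/ c i = 8)%N ->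
    W c = hv one one one.
  move=> cM [i ci]; rewrite /W.
  have -> : sphere_label (c ord0) (c ord_max) = (0, 0, 0)%N; last by [].
  have : c ord0 \in [:: 0; 8]%N \/ c ord_max \in [:: 0; 8]%N.
    have [ij|ij] : i = ord0 \/ i = ord_max.
      by case: i {ci} => -[|[|//]] ?; [left|right]; exact: val_inj.
      by left; rewrite -ij !inE; case: ci => ->.
    by right; rewrite -ij !inE; case: ci => ->.
  have c0 : c ord0 \in iota 0 9 by rewrite mem_iota ltnS cM.
  have c1 : c ord_max \in iota 0 9 by rewrite mem_iota ltnS cM.
  move: (c ord0) (c ord_max) c0 c1 => p q p9 q9 pq; apply/eqP.
  have /allP/(_ p p9)/allP/(_ q q9)/implyP : all (fun p => all (fun q =>
    ((p \in [:: 0; 8]) || (q \in [:: 0; 8]))%N ==> (sphere_label p q == (0, 0, 0)%N))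
    (iota 0 9)) (iota 0 9) by vm_compute.
  by apply; apply/orP.
have [m [u [phi [[u0 um uS] phi0 phib phix]]]] :=
  grid_nullhomotopy (isT : (0 < 8)%N) Wcmp Wb (pi2 _).
pose idx (i j : nat) (l : 'I_2) : nat := if l == ord0 then i else j.
have repb v : v = hv one one one -> rep v = one by move=> ->; exact: coset_rep_diag.
pose psi i j k := rep (phi (idx i j) k).
have idxP (Q : nat -> Prop) i j : Q i -> Q j -> forall l, Q (idx i j l).
  by move=> Qi Qj l; rewrite /idx; case: ifP.
have uM i : (i <= m)%N -> (u i <= 8)%N.
  move=> im; rewrite -um; elim: m im {um phi0 phib phix} => [|n IH].
    by rewrite leqn0 => /eqP ->.
  rewrite leq_eqVlt => /orP[/eqP ->//|]; rewrite ltnS => /IH h.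
  by apply: leq_trans h _; case: (uS n) => ->.
have sum0 : \sum_(0 <= i < m) \sum_(0 <= j < m)
    square_cochain T (psi i j 0%N) (psi i.+1 j 0%N) (psi i j.+1 0%N) (psi i.+1 j.+1 0%N) = 0.
  apply: (@stokes_cube _ _ T psi one m m.+1).
  - exact: triple1l.
  (* The corners of a cell support one point, hence have representatives in one coset [D]; the cone
     from any point of [D] is a primitive there. *)
  - move=> i j k im jm km.
    have [|//|x xP] := phix (idx i j) k; first exact: (idxP (fun n => n < m)%N).
    have [D FD DP] := support_coset x.
    have [y0 Dy0] := left_coset_neq0 FD.
    exists D, (T y0); split.
      by move=> y z w Dy Dz Dw; exact: (triple_coboundary nil3 engelG FD Dy0 Dy Dz Dw).
    move=> i' j' k' i1 j1 k1; apply: DP (coset_rep_mem _ _).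
    rewrite (_ : idx (i' + i)%N (j' + j)%N = (fun l => idx i' j' l + idx i j l)%N).
      by apply: xP => //; exact: (idxP (fun n => n <= 1)%N).
    by apply/funext => l; rewrite /idx; case: ifP.
  - move=> j k jm km; apply: repb; apply: phib => //; last by left; exists ord0; left.
    exact: (idxP (fun n => n <= m)%N).
  - move=> j k jm km; apply: repb; apply: phib => //; last by left; exists ord0; right.
    exact: (idxP (fun n => n <= m)%N).
  - move=> i k im km; apply: repb; apply: phib => //; last by left; exists ord_max; left.
    exact: (idxP (fun n => n <= m)%N).
  - move=> i k im km; apply: repb; apply: phib => //; last by left; exists ord_max; right.
    exact: (idxP (fun n => n <= m)%N).
  - move=> i j im jm; apply: repb; apply: phib => //; last by right.
    exact: (idxP (fun n => n <= m)%N).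
pose w i j := tetra (sphere_label i j).1.1.
have psiE i j : (i <= m)%N -> (j <= m)%N -> psi i j 0%N = w (u i) (u j).
  move=> im jm; rewrite /psi phi0; last exact: (idxP (fun n => n <= m)%N).
  by rewrite /W /=; apply: coset_rep_sphere_label; exact: uM.
move: sum0.
rewrite (@eq_big_nat _ _ _ _ _ _ (fun i => \sum_(0 <= j < m) square_cochain T
  (w (u i) (u j)) (w (u i.+1) (u j)) (w (u i) (u j.+1)) (w (u i.+1) (u j.+1)))); last first.
  move=> i /andP[_ im]; apply: eq_big_nat => j /andP[_ jm].
  by rewrite !psiE // ltnW.
rewrite square_sum_monotone_steps //; first last.
- exact: triplexyy.
- exact: triplexx.
pose s i j : int :=
  tetra_sign (sphere_label i j).1.1 (sphere_label i.+1 j).1.1 (sphere_label i.+1 j.+1).1.1 -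
  tetra_sign (sphere_label i j).1.1 (sphere_label i j.+1).1.1 (sphere_label i.+1 j.+1).1.1.
rewrite um (eq_bigr (fun i => T a b d *~ \sum_(0 <= j < 8) s i j)) => [|i _]; last first.
  rewrite mulrz_sumr; apply: eq_bigr => j _.
  by rewrite /square_cochain /w !triple_tetra -mulrzBr.
(* Evaluating the table shows that T(a, b, d) is counted -1 times, the degree of the unfolded sphere
   up to orientation. *)
rewrite -mulrz_sumr (_ : \sum_(0 <= i < 8) _ = -1); last by rewrite unlock; vm_compute.
by rewrite mulrN1z => /eqP; rewrite oppr_eq0 (negbTE abd).
Qed.
End SphereObstruction.

Lemma pi2_trivial_class2 : two_engel G ->
  (forall x0 : X, homotopy_group_trivial R 2 x0) -> nilpotent_class_le 2 [set: G].
Proof.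
move=> engelG pi2; apply/nilpotent_class_le2P => a b d _ _ _.
apply/eqP; rewrite -triple_eq0 //; apply/negPn/negP => abd.
exact: (pi2_nontrivial engelG abd).
Qed.
End Obstructions.

Theorem theorem1p1 (R : realType) (G : groupType)
    (nilG : nilpotent_class_le 3 [set: G]%classic)
    (expG : exponent_dvd 3
      (commutator_subgroup
        (commutator_subgroup [set: G]%classic [set: G]%classic)
        [set: G]%classic)) :
  (k_connected R (coset_complex R (@nilpotent_subgroups G 2)) 1 <->
     two_engel G) /\
  (k_connected R (coset_complex R (@nilpotent_subgroups G 2)) 2 <->
     nilpotent_class_le 2 [set: G]%classic).
Proof.
have nil3 := nilpotent_class_le3_commg nilG.
have exp3 (x y z : G) : ([~ x, y, z] ^+ 3 = 1)%g.
  by apply: expG; apply: commutator_subgroup_mem => //; exact: commutator_subgroup_mem.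
have engel : k_connected R (coset_complex R (@nilpotent_subgroups G 2)) 1 ->
    two_engel G.
  by move=> [_ tr]; apply: (@pi1_trivial_engel R G nil3 exp3) => x0; exact: tr.
split; split => [con|hG].
- exact: engel.
- exact: engel_1connected.
(* A 2-connected complex is 1-connected, so part (i) supplies the Engel identity on which the
   2-cocycle rests. *)
- have [[X0 tr] engelG] : k_connected R (coset_complex R (@nilpotent_subgroups G 2)) 2 /\
      two_engel G.
    split => //; apply: engel; case: con => X0 tr; split => // i x0 i1.
    by apply: tr; exact: leqW.
  by apply: (@pi2_trivial_class2 R G nil3 engelG) => x0; exact: tr.
- split; first by exists (vertex R (hull_vertex (1%g : G) 1%g 1%g)).
  by move=> i x0 _; exact: class2_homotopy_trivial.
Qed.
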